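(* For every integer $n\ge 1$ the 2-typical de Rham-Witt complex $W_\bullet\Omega^*_{\mathbb Z}$ of the ring $\mathbb Z$ has the following structure, where $V^i(1)\in W_n\Omega^0_{\mathbb Z}$ denotes $V^i([1]_{n-i})$ and $dV^i(1)\in W_n\Omega^1_{\mathbb Z}$ its image under $d$. (i) As abelian groups, $$W_n\Omega^0_{\mathbb Z}=\bigoplus_{i=0}^{n-1}\mathbb Z\cdot V^i(1),\qquad W_n\Omega^1_{\mathbb Z}=\bigoplus_{i=1}^{n-1}\mathbb Z/2^i\mathbb Z\cdot dV^i(1),\qquad W_n\Omega^i_{\mathbb Z}=0\ \text{ for } i\ge 2 .$$ (That is, $W_n\Omega^0_{\mathbb Z}$ is free on the $V^i(1)$, and $W_n\Omega^1_{\mathbb Z}$ is the direct sum of the cyclic subgroups generated by the $dV^i(1)$, which have order exactly $2^i$.) (ii) The product is given by $V^i(1)\cdot V^j(1)=2^iV^j(1)$ if $i\le j$, and $$V^i(1)\cdot dV^j(1)=\begin{cases}2^i\,dV^j(1)+\sum_{s=j+1}^{n-1}2^{s-1}dV^s(1), & 1\le i<j,\\ \sum_{s=i+1}^{n-1}2^{s-1}dV^s(1), & 1\le j\le i.\end{cases}$$ (iii) $V:W_n\Omega^*_{\mathbb Z}\to W_{n+1}\Omega^*_{\mathbb Z}$ is given by $V(V^i(1))=V^{i+1}(1)$ and $V(dV^i(1))=2\,dV^{i+1}(1)$. (iv) $F:W_n\Omega^*_{\mathbb Z}\to W_{n-1}\Omega^*_{\mathbb Z}$ is given, for $i\ge1$,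 by $F(V^i(1))=2V^{i-1}(1)$ and $F(dV^i(1))=dV^{i-1}(1)+\sum_{s=i}^{n-2}2^{s-1}dV^s(1)$. (v) $d(V^i(1))=dV^i(1)$ for $i\ge 1$, $d(1)=0$, and $\iota(V^i(1))=\sum_{s=i+1}^{n-1}2^{s-1}dV^s(1)$. (vi) $R:W_n\Omega^*_{\mathbb Z}\to W_{n-1}\Omega^*_{\mathbb Z}$ sends $V^i(1)\mapsto V^i(1)$ and $dV^i(1)\mapsto dV^i(1)$ if $i\le n-2$, and sends $V^{n-1}(1)$ and $dV^{n-1}(1)$ to $0$.
   Context: All rings are commutative and unital; graded rings are graded-commutative, i.e. $xy=(-1)^{|x||y|}yx$. For a ring $A$, $W_n(A)$ is the ring of 2-typical Witt vectors of length $n$ ($W_n(A)=0$ for $n\le 0$), with restriction $R:W_n(A)\to W_{n-1}(A)$, Frobenius $F:W_n(A)\to W_{n-1}(A)$, Verschiebung $V:W_{n}(A)\to W_{n+1}(A)$, and Teichmüller map $[a]_n=(a,0,\dots,0)$. A pro-object is a sequence $\{X_n\}_{n\in\mathbb Z}$ with maps $R:X_n\to X_{n-1}$; a strict map of pro-objects is a family of maps commuting with $R$. A 2-typical Witt complex over $A$ consists of: (i) a graded-commutative pro-graded ring $\{E_n^*,R:E_n^*\to E_{n-1}^*\}_{n\in\mathbb Z}$ with $E_n^*=0$ for $n\le0$; (ii) a strict map of pro-rings $\lambda:W_\bullet(A)\to E^0_\bullet$; (iii) a strict map of pro-graded rings $F:E^*_\bullet\to E^*_{\bullet-1}$ with $\lambda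 F=F\lambda$; (iv) a strict map of pro-graded abelian groups $V:E^*_\bullet\to E^*_{\bullet+1}$ with $V(x)y=V(xF(y))$, $\lambda V=V\lambda$ and $FV=2$; (v) a strict map of pro-graded abelian groups $d:E^*_\bullet\to E^{*+1}_\bullet$ with $d(xy)=d(x)y+(-1)^{|x|}x\,d(y)$. Let $\iota:E_n^*\to E_n^{*+1}$ be multiplication by $\frac{d\lambda[-1]_n}{\lambda[-1]_n}$. One requires $FdV=d+\iota$, $dd=d\iota=\iota d$, and $Fd\lambda([a]_n)=\lambda([a]_{n-1})\,d\lambda([a]_{n-1})$ for all $a\in A$. A morphism of Witt complexes is a map of pro-graded rings commuting with $\lambda,d,F,V$. The category of 2-typical Witt complexes over $A$ has an initial object, the 2-typical de Rham-Witt complex $W_\bullet\Omega^*_A$ of $A$. The map $\lambda$ is suppressed from the notation. *)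

(* Defs.v *)
From HB Require Import structures.
From mathcomp Require Import all_boot all_order all_algebra.
From mathcomp Require Import mpoly.

Set Implicit Arguments.
Unset Strict Implicit.
Unset Printing Implicit Defensive.

Import GRing.Theory Num.Theory.

Local Open Scope ring_scope.

(* The operations on 2-typical Witt vectors of length n are evaluations of
   universal integer polynomials, determined by their ghost components. *)

(* w_m(x) = \sum_(i <= m) 2^i x_i^(2^(m-i)), meaningful for m < n. *)
Definition ghost (A : pzRingType) n (x : 'I_n -> A) (m : nat) : A :=
  \sum_(i < n | (i <= m)%N) x i ^+ (2 ^ (m - i)) *+ 2 ^ i.

(* Evaluation of integer polynomials in a possibly zero ring (mmap needs a
   nonzero target). *)
Definition weval (A : comPzRingType) k (v : 'I_k -> A) (p : {mpoly int[k]}) :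
    A :=
  \sum_(m <- msupp p) (\prod_(i < k) v i ^+ m i) *~ p@_m.

(* Coefficientwise quotient by q; only used when q divides p. *)
Definition mpoly_divz k (q : nat) (p : {mpoly int[k]}) : {mpoly int[k]} :=
  \sum_(m <- msupp p) (p@_m %/ q)%Z *: 'X_[m].

(* The first m terms of the sequence s with ghost components z, by
   s_m = (z_m - \sum_(i < m) 2^i s_i^(2^(m-i))) / 2^m; the division is exact
   when z satisfies the congruence [dwork] below, see [ghost_unghost]. *)
Fixpoint unghost_seq k (z : nat -> {mpoly int[k]}) (m : nat) :
    seq {mpoly int[k]} :=
  if m is m'.+1 then
    let s := unghost_seq z m' in
    rcons s (mpoly_divz (2 ^ m')
      (z m' - \sum_(i < m') s`_i ^+ (2 ^ (m' - i)) *+ 2 ^ i))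
  else [::].

Definition unghost k (z : nat -> {mpoly int[k]}) (m : nat) : {mpoly int[k]} :=
  (unghost_seq z m.+1)`_m.

Record witt (n : nat) (A : Type) := Witt { wval : {ffun 'I_n -> A} }.

HB.instance Definition _ n A := [isNew for @wval n A].
HB.instance Definition _ n (A : choiceType) := [Choice of witt n A by <:].

Definition wcoord n A (x : witt n A) (i : 'I_n) : A := wval x i.
Coercion wcoord : witt >-> Funclass.

Definition unghost_eval n (A : comPzRingType) k
    (z : nat -> {mpoly int[k]}) (v : 'I_k -> A) : witt n A :=
  Witt [ffun i : 'I_n => weval v (unghost z i)].

Definition pairv T n (x y : 'I_n -> T) (i : 'I_(n + n)) : T :=
  match split i with inl j => x j | inr j => y j end.

Definition varl n (i : 'I_n) : {mpoly int[n + n]} := 'X_(lshift n i).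
Definition varr n (i : 'I_n) : {mpoly int[n + n]} := 'X_(rshift n i).
Definition var n (i : 'I_n) : {mpoly int[n]} := 'X_i.

Definition teich (A : pzRingType) (n : nat) (a : A) : witt n A :=
  Witt [ffun i : 'I_n => if val i == 0%N then a else 0].

Definition witt_zero (A : pzRingType) (n : nat) : witt n A :=
  Witt [ffun=> (0 : A)].

Definition witt_one (A : pzRingType) (n : nat) : witt n A := teich n 1.

HB.lock Definition witt_add (A : comPzRingType) (n : nat) (x y : witt n A) :
    witt n A :=
  unghost_eval n (fun m => ghost (@varl n) m + ghost (@varr n) m) (pairv x y).

HB.lock Definition witt_mul (A : comPzRingType) (n : nat) (x y : witt n A) :
    witt n A :=
  unghost_eval n (fun m => ghost (@varl n) m * ghost (@varr n) m) (pairv x y).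

HB.lock Definition witt_opp (A : comPzRingType) (n : nat) (x : witt n A) :
    witt n A :=
  unghost_eval n (fun m => - ghost (@var n) m) x.

Definition wittR (A : pzRingType) (n : nat) (x : witt n.+1 A) : witt n A :=
  Witt [ffun i : 'I_n => x (widen_ord (leqnSn n) i)].

HB.lock Definition wittF (A : comPzRingType) (n : nat) (x : witt n.+1 A) :
    witt n A :=
  unghost_eval n (fun m => ghost (@var n.+1) m.+1) x.

Definition wittV (A : pzRingType) (n : nat) (x : witt n A) : witt n.+1 A :=
  Witt [ffun i : 'I_n.+1 => if unlift ord0 i is Some j then x j else (0 : A)].

Lemma weval_mmap (A : comNzRingType) k (v : 'I_k -> A) p :
  weval v p = mmap intr v p.
Proof. by apply: eq_bigr => m _; rewrite mulrzl. Qed.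

Section NonTrivial.
Variables (A : comPzRingType) (A1 : (1 : A) != 0).
Definition nz_of : Type := let _ := A1 in A.
HB.instance Definition _ := GRing.ComPzRing.on nz_of.
HB.instance Definition _ := GRing.PzSemiRing_isNonZero.Build nz_of A1.
End NonTrivial.

Lemma trivial_ring (A : pzRingType) (x y : A) : (1 : A) = 0 -> x = y.
Proof. by move=> A1; rewrite -[x]mulr1 -[y]mulr1 A1 !mulr0. Qed.

Section Weval.
Variables (A : comPzRingType) (k : nat) (v : 'I_k -> A).

Lemma weval_nz (A1 : (1 : A) != 0) p :
  weval v p = mmap (intr : int -> nz_of A1) v p.
Proof. exact: (@weval_mmap (nz_of A1)). Qed.

Fact weval_is_zmod_morphism : zmod_morphism (weval v).
Proof.
move=> p q; case: (eqVneq (1 : A) 0) => [A0|A1]; first by apply: trivial_ring.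
by rewrite !(weval_nz A1) raddfB.
Qed.

Fact weval_is_monoid_morphism : monoid_morphism (weval v).
Proof.
case: (eqVneq (1 : A) 0) => [A0|A1].
  by split=> [|p q]; apply: trivial_ring.
split=> [|p q]; first by rewrite (weval_nz A1) rmorph1.
by rewrite !(weval_nz A1) rmorphM.
Qed.

HB.instance Definition _ := GRing.isZmodMorphism.Build
  {mpoly int[k]} A (weval v) weval_is_zmod_morphism.
HB.instance Definition _ := GRing.isMonoidMorphism.Build
  {mpoly int[k]} A (weval v) weval_is_monoid_morphism.

Lemma wevalX i : weval v 'X_i = v i.
Proof.
case: (eqVneq (1 : A) 0) => [A0|A1]; first by apply: trivial_ring.
by rewrite (weval_nz A1) mmapX mmap1U.
Qed.

End Weval.

Lemma weval_comp (A B : comPzRingType) (f : {rmorphism A -> B}) k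
    (v : 'I_k -> A) (w : 'I_k -> B) p :
  (forall i, f (v i) = w i) -> f (weval v p) = weval w p.
Proof.
move=> fv; rewrite /weval rmorph_sum; apply: eq_bigr => m _.
rewrite rmorphMz rmorph_prod; congr (_ *~ _).
by apply: eq_bigr => i _; rewrite rmorphXn /= fv.
Qed.

Lemma rmorph_ghost (A B : pzRingType) (f : {rmorphism A -> B}) n
    (x : 'I_n -> A) (y : 'I_n -> B) m :
  (forall i, f (x i) = y i) -> f (ghost x m) = ghost y m.
Proof.
move=> fx; rewrite /ghost rmorph_sum; apply: eq_bigr => i _.
by rewrite rmorphMn rmorphXn /= fx.
Qed.

Lemma mpoly_divzK k q (p : {mpoly int[k]}) :
  (0 < q)%N -> mpoly_divz q (p *+ q) = p.
Proof.
move=> q0; rewrite /mpoly_divz -scaler_nat.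
have qn0 : (q%:R : int) != 0 by rewrite pnatr_eq0 -lt0n.
rewrite (perm_big _ (msuppZ p qn0)) [RHS]mpolyE; apply: eq_bigr => m _.
by rewrite mcoeffZ natz mulKz // eqz_nat -lt0n.
Qed.

Lemma mpoly_mulrn_inj k q (p r : {mpoly int[k]}) :
  (0 < q)%N -> p *+ q = r *+ q -> p = r.
Proof.
by move=> q0 eq_pr; rewrite -(mpoly_divzK p q0) eq_pr mpoly_divzK.
Qed.

Section Dwork.
Variable k : nat.
Implicit Types (p : {mpoly int[k]}) (z : nat -> {mpoly int[k]}).

Definition frob : {mpoly int[k]} -> {mpoly int[k]} :=
  weval (fun i => ('X_i : {mpoly int[k]}) ^+ 2).

HB.instance Definition _ := GRing.RMorphism.on frob.

Definition congm (q : nat) p1 p2 := exists r, p1 = p2 + r *+ q.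

Definition dwork z := forall m, congm (2 ^ m.+1) (z m.+1) (frob (z m)).

Lemma congm_refl q p : congm q p p.
Proof. by exists 0; rewrite mul0rn addr0. Qed.

Lemma congm_trans q p1 p2 p3 : congm q p1 p2 -> congm q p2 p3 -> congm q p1 p3.
Proof. by case=> r -> [s ->]; exists (s + r); rewrite mulrnDl addrA. Qed.

Lemma congm_sym q p1 p2 : congm q p1 p2 -> congm q p2 p1.
Proof. by case=> r ->; exists (- r); rewrite mulNrn addrK. Qed.

Lemma congmD q p1 p2 p3 p4 :
  congm q p1 p2 -> congm q p3 p4 -> congm q (p1 + p3) (p2 + p4).
Proof. by case=> r -> [s ->]; exists (r + s); rewrite mulrnDl addrACA. Qed.

Lemma congmN q p1 p2 : congm q p1 p2 -> congm q (- p1) (- p2).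
Proof. by case=> r ->; exists (- r); rewrite mulNrn opprD. Qed.

Lemma congmM q p1 p2 p3 p4 :
  congm q p1 p2 -> congm q p3 p4 -> congm q (p1 * p3) (p2 * p4).
Proof.
case=> r -> [s ->]; exists (p2 * s + r * p4 + r * s *+ q).
rewrite mulrDl !mulrDr !mulrnAl !mulrnAr !mulrnDl -!addrA.
by rewrite -?mulrnAl.
Qed.

Lemma congm_sum q I (r : seq I) (P : pred I) (F G : I -> {mpoly int[k]}) :
  (forall i, P i -> congm q (F i) (G i)) ->
  congm q (\sum_(i <- r | P i) F i) (\sum_(i <- r | P i) G i).
Proof.
by move=> FG; elim/big_ind2: _ => [|*|//]; [exact: congm_refl | exact: congmD].
Qed.

Lemma congm_mulrn q c p1 p2 :
  congm q p1 p2 -> congm (q * c) (p1 *+ c) (p2 *+ c).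
Proof. by case=> r ->; exists r; rewrite mulrnDl mulrnA. Qed.

Lemma congm_sqr m p1 p2 :
  congm (2 ^ m.+1) p1 p2 -> congm (2 ^ m.+2) (p1 ^+ 2) (p2 ^+ 2).
Proof.
case=> r ->; exists (p2 * r + r ^+ 2 *+ 2 ^ m).
rewrite sqrrD mulrnAr exprMn_n -addrA; congr (_ + _).
rewrite mulrnDl -!mulrnA -expnM; congr (_ + _).
  by rewrite -expnSr.
by rewrite -expnD muln2 -addnn !addSn !addnS.
Qed.

Lemma congm_exp m j p1 p2 :
  congm (2 ^ m.+1) p1 p2 ->
  congm (2 ^ (j + m).+1) (p1 ^+ (2 ^ j)) (p2 ^+ (2 ^ j)).
Proof.
move=> p12; elim: j => [|j IHj]; first by rewrite !expr1.
by rewrite addSn (expnSr 2 j) !exprM; apply: congm_sqr.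
Qed.

Lemma frob_sqr p : congm 2 (p ^+ 2) (frob p).
Proof.
pose good p := congm 2 (p ^+ 2) (frob p).
have goodD p1 p2 : good p1 -> good p2 -> good (p1 + p2).
  move=> g1 g2; rewrite /good rmorphD /= sqrrD addrAC.
  apply: (@congm_trans _ _ (p1 ^+ 2 + p2 ^+ 2)); last exact: congmD.
  by exists (p1 * p2).
have goodM p1 p2 : good p1 -> good p2 -> good (p1 * p2).
  by move=> g1 g2; rewrite /good rmorphM /= exprMn; apply: congmM.
have good1 : good 1 by rewrite /good rmorph1 expr1n; apply: congm_refl.
have good0 : good 0 by rewrite /good rmorph0 expr0n; apply: congm_refl.
have goodN p1 : good p1 -> good (- p1).
  move=> g1; rewrite /good sqrrN rmorphN.
  apply: congm_trans g1 _; exists (frob p1).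
  by rewrite mulr2n addrA addNr add0r.
have goodXn p1 j : good p1 -> good (p1 ^+ j).
  by move=> g1; elim: j => [|j IHj]; rewrite ?expr0 // exprS; apply: goodM.
have goodMn p1 j : good p1 -> good (p1 *+ j).
  by move=> g1; elim: j => [|j IHj]; rewrite ?mulr0n // mulrS; apply: goodD.
elim/mpolyind: p => [|c m p _ _ gp]; first exact: good0.
apply: (goodD) gp; rewrite -mul_mpolyC; apply: (goodM).
  rewrite -[c]intz rmorph_int; case: c => j; first exact: goodMn.
  by rewrite NegzE mulrNz; apply: (goodN); exact: goodMn.
rewrite mpolyXE_id; elim/big_ind: _ => [//|//|i _].
apply: (goodXn); rewrite /good /frob wevalX; exact: congm_refl.
Qed.

Lemma dwork_ghost n (x : 'I_n -> {mpoly int[k]}) :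
  (forall i, frob (x i) = x i ^+ 2) -> dwork (ghost x).
Proof.
move=> frobx m.
exists (\sum_(i < n | (i <= m.+1)%N && ~~ (i <= m)%N) x i).
rewrite /ghost (bigID (fun i : 'I_n => (i <= m)%N)) /=; congr (_ + _).
  rewrite rmorph_sum; apply: eq_big => [i|i /andP[_ im]] /=.
    by case: (leqP i m) => im; rewrite ?andbF ?(leqW im).
  by rewrite rmorphMn rmorphXn /= frobx -exprM -expnS subSn.
rewrite -sumrMnl; apply: eq_bigr => i /andP[im /negbTE im'].
have -> : i = m.+1 :> nat by apply/eqP; rewrite eqn_leq im ltnNge im'.
by rewrite subnn expr1.
Qed.

Lemma dworkD z1 z2 : dwork z1 -> dwork z2 -> dwork (fun m => z1 m + z2 m).
Proof. by move=> d1 d2 m; rewrite rmorphD; apply: congmD. Qed.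

Lemma dworkM z1 z2 : dwork z1 -> dwork z2 -> dwork (fun m => z1 m * z2 m).
Proof. by move=> d1 d2 m; rewrite rmorphM; apply: congmM. Qed.

Lemma dworkN z : dwork z -> dwork (fun m => - z m).
Proof. by move=> d m; rewrite rmorphN; apply: congmN. Qed.

Lemma dworkS z : dwork z -> dwork (fun m => z m.+1).
Proof.
move=> d m; have [r ->] := d m.+1; exists (r *+ 2).
by rewrite -mulrnA -expnS.
Qed.

Lemma size_unghost_seq z m : size (unghost_seq z m) = m.
Proof. by elim: m => //= m IHm; rewrite size_rcons IHm. Qed.

Lemma nth_unghost_seq z m i : (i < m)%N -> (unghost_seq z m)`_i = unghost z i.
Proof.
elim: m => // m IHm; rewrite ltnS leq_eqVlt => /predU1P[->//|im].
by rewrite /= nth_rcons size_unghost_seq im IHm.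
Qed.

Lemma unghostE z m :
  unghost z m =
  mpoly_divz (2 ^ m) (z m - \sum_(i < m) unghost z i ^+ (2 ^ (m - i)) *+ 2 ^ i).
Proof.
rewrite /unghost /= nth_rcons size_unghost_seq ltnn eqxx; congr mpoly_divz.
by congr (_ - _); apply: eq_bigr => i _; rewrite nth_unghost_seq.
Qed.

Lemma ghost_unghost z m : dwork z ->
  \sum_(i < m.+1) unghost z i ^+ (2 ^ (m - i)) *+ 2 ^ i = z m.
Proof.
move=> dz; elim: m => [|m IHm].
  rewrite big_ord1 expr1 mulr1n unghostE big_ord0 subr0.
  exact: (mpoly_divzK (z 0%N) (q := 1)).
rewrite big_ord_recr /= subnn expr1 unghostE.
set s := \sum_(i < m.+1) _ *+ _.
suff [r ->] : congm (2 ^ m.+1) (z m.+1) s.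
  by rewrite [s + r *+ _]addrC addrK mpoly_divzK ?expn_gt0 // addrC.
apply: congm_trans (dz m) _; rewrite -IHm rmorph_sum /=.
apply: congm_sum => i _; rewrite rmorphMn rmorphXn /=.
have im : (i <= m)%N by rewrite -ltnS.
rewrite subSn // (expnS 2 (m - i)) exprM.
have -> : (2 ^ m.+1 = 2 ^ (m - i + 0).+1 * 2 ^ i)%N.
  by rewrite addn0 -expnD addSn subnK.
by apply: congm_mulrn; apply: congm_exp; apply: congm_sym; apply: frob_sqr.
Qed.

End Dwork.

Lemma wittP n A (x y : witt n A) : (forall i, x i = y i) -> x = y.
Proof. by move=> xy; apply: val_inj; apply/ffunP => i; apply: xy. Qed.

Lemma eq_ghost (A : pzRingType) n (x y : 'I_n -> A) m :
  x =1 y -> ghost x m = ghost y m.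
Proof. by move=> xy; apply: eq_bigr => i _; rewrite xy. Qed.

Lemma ghost_unghost_eval n (A : comPzRingType) k z (v : 'I_k -> A) m :
  (m < n)%N -> dwork z -> ghost (unghost_eval n z v) m = weval v (z m).
Proof.
move=> mn dz; rewrite -(ghost_unghost m dz) rmorph_sum /= /ghost.
rewrite (big_ord_widen n
  (fun i => weval v (unghost z i ^+ (2 ^ (m - i)) *+ 2 ^ i)) mn) /=.
apply: eq_bigr => i _.
by rewrite rmorphMn rmorphXn /= /wcoord ffunE.
Qed.

Section GhostMorphism.
Variables (A : comPzRingType) (n : nat).
Implicit Types x y : witt n A.

Lemma dwork_var k (f : 'I_n -> 'I_k) :
  dwork (ghost (fun i => 'X_(f i) : {mpoly int[k]})).
Proof. by apply: dwork_ghost => i; apply: wevalX. Qed.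

Lemma ghost_varl x y m : weval (pairv x y) (ghost (@varl n) m) = ghost x m.
Proof.
apply: rmorph_ghost => i; rewrite /varl /= wevalX /pairv.
by rewrite (unsplitK (inl i : 'I_n + 'I_n)).
Qed.

Lemma ghost_varr x y m : weval (pairv x y) (ghost (@varr n) m) = ghost y m.
Proof.
apply: rmorph_ghost => i; rewrite /varr /= wevalX /pairv.
by rewrite (unsplitK (inr i : 'I_n + 'I_n)).
Qed.

Lemma ghostD x y m :
  (m < n)%N -> ghost (witt_add x y) m = ghost x m + ghost y m.
Proof.
move=> mn; rewrite witt_add.unlock; rewrite ghost_unghost_eval //.
  by rewrite rmorphD /= ghost_varl ghost_varr.
by apply: dworkD; apply: dwork_var.
Qed.

Lemma ghostM x y m :
  (m < n)%N -> ghost (witt_mul x y) m = ghost x m * ghost y m.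
Proof.
move=> mn; rewrite witt_mul.unlock; rewrite ghost_unghost_eval //.
  by rewrite rmorphM /= ghost_varl ghost_varr.
by apply: dworkM; apply: dwork_var.
Qed.

Lemma ghostN x m : (m < n)%N -> ghost (witt_opp x) m = - ghost x m.
Proof.
move=> mn; rewrite witt_opp.unlock; rewrite ghost_unghost_eval //.
  by rewrite rmorphN /=; congr (- _); apply: rmorph_ghost => i; apply: wevalX.
by apply: dworkN; apply: dwork_var.
Qed.

Lemma ghost_teich (a : A) m : (m < n)%N -> ghost (teich n a) m = a ^+ (2 ^ m).
Proof.
case: n => // n' _; rewrite /ghost (bigD1 ord0) //= big1 => [|i /andP[_ i0]].
  by rewrite addr0 /wcoord ffunE /= subn0.
rewrite /wcoord ffunE /= ifN; last by apply: contraNneq i0 => /eqP.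
by rewrite expr0n expn_eq0 mul0rn.
Qed.

Lemma ghost0 m : ghost (witt_zero A n) m = 0.
Proof.
by apply: big1 => i _; rewrite /wcoord ffunE expr0n expn_eq0 mul0rn.
Qed.

Lemma ghost1 m : (m < n)%N -> ghost (witt_one A n) m = 1.
Proof. by move=> mn; rewrite ghost_teich // expr1n. Qed.

End GhostMorphism.

Lemma ghostF (A : comPzRingType) n (x : witt n.+1 A) m :
  (m < n)%N -> ghost (wittF x) m = ghost x m.+1.
Proof.
move=> mn; rewrite wittF.unlock; rewrite ghost_unghost_eval //.
  by apply: rmorph_ghost => i; apply: wevalX.
exact/dworkS/dwork_var.
Qed.

Lemma ghostV (A : comPzRingType) n (x : witt n A) m :
  (m < n)%N -> ghost (wittV x) m.+1 = ghost x m *+ 2.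
Proof.
move=> mn; rewrite /ghost big_mkcond big_ord_recl [in LHS]/wcoord ffunE.
rewrite unlift_none expr0n expn_eq0 /= mul0rn add0r -sumrMnl [RHS]big_mkcond.
apply: eq_bigr => i _; rewrite /wcoord ffunE liftK.
by rewrite -mulrnA -expnSr.
Qed.

Lemma ghostR (A : comPzRingType) n (x : witt n.+1 A) m :
  (m < n)%N -> ghost (wittR x) m = ghost x m.
Proof.
move=> mn; rewrite /ghost [RHS]big_mkcond big_ord_recr /= leqNgt mn addr0.
by rewrite -big_mkcond; apply: eq_bigr => i _; rewrite /wcoord ffunE.
Qed.

(* The ring axioms are reduced to rings of integer polynomials, where the ghost
   map is injective. *)

Definition witt_map (A B : Type) (f : A -> B) n (x : witt n A) : witt n B :=
  Witt [ffun i => f (x i)].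

Section Naturality.
Variables (A B : comPzRingType) (f : {rmorphism A -> B}) (n : nat).
Implicit Types x y : witt n A.

Lemma witt_map_unghost k z (v : 'I_k -> A) (w : 'I_k -> B) :
  (forall i, f (v i) = w i) ->
  witt_map f (unghost_eval n z v) = unghost_eval n z w.
Proof.
move=> fv; apply: wittP => i; rewrite /wcoord !ffunE /wcoord ffunE.
exact: weval_comp.
Qed.

Lemma witt_mapE x i : witt_map f x i = f (x i).
Proof. by rewrite /witt_map {1}/wcoord ffunE. Qed.

Lemma pairv_map x y i :
  f (pairv x y i) = pairv (witt_map f x) (witt_map f y) i.
Proof. by rewrite /pairv; case: split => j; rewrite witt_mapE. Qed.

Lemma witt_mapD x y :
  witt_map f (witt_add x y) = witt_add (witt_map f x) (witt_map f y).
Proof. by rewrite witt_add.unlock; apply/witt_map_unghost/pairv_map. Qed.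

Lemma witt_mapM x y :
  witt_map f (witt_mul x y) = witt_mul (witt_map f x) (witt_map f y).
Proof. by rewrite witt_mul.unlock; apply/witt_map_unghost/pairv_map. Qed.

Lemma witt_mapN x : witt_map f (witt_opp x) = witt_opp (witt_map f x).
Proof.
by rewrite witt_opp.unlock; apply: witt_map_unghost => i; rewrite witt_mapE.
Qed.

Lemma witt_map_teich (a : A) : witt_map f (teich n a) = teich n (f a).
Proof.
apply: wittP => i; rewrite witt_mapE /wcoord !ffunE.
by case: ifP => // _; apply: rmorph0.
Qed.

Lemma witt_map0 : witt_map f (witt_zero A n) = witt_zero B n.
Proof. by apply: wittP => i; rewrite witt_mapE /wcoord !ffunE rmorph0. Qed.

End Naturality.

Lemma ghost_inj n k (x y : witt n {mpoly int[k]}) :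
  (forall m, (m < n)%N -> ghost x m = ghost y m) -> x = y.
Proof.
move=> xy; apply: wittP; case; elim/ltn_ind => m IHm mn.
have := xy m mn; rewrite /ghost.
rewrite (bigD1 (Ordinal mn)) //= [RHS](bigD1 (Ordinal mn)) //=.
rewrite (eq_bigr (fun i => y i ^+ (2 ^ (m - i)) *+ 2 ^ i)).
  move/addIr; rewrite subnn !expr1; apply: mpoly_mulrn_inj.
  by rewrite expn_gt0.
case=> i lt_in /andP[/= im inm]; rewrite IHm // ltn_neqAle im andbT.
by apply: contraNneq inm => eim; apply/eqP/val_inj.
Qed.

Lemma witt_lift3 (A : comPzRingType) n (a b c : witt n A) :
  exists k (f : {rmorphism {mpoly int[k]} -> A}) x y z,
  [/\ a = witt_map f x, b = witt_map f y & c = witt_map f z].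
Proof.
pose v := fun i : 'I_(n + (n + n)) => match split i with
  | inl j => a j | inr j => pairv b c j end.
exists (n + (n + n))%N, (weval v).
exists (Witt [ffun i => 'X_(lshift (n + n) i)]).
exists (Witt [ffun i => 'X_(rshift n (lshift n i))]).
exists (Witt [ffun i => 'X_(rshift n (rshift n i))]).
split; apply: wittP => i; rewrite witt_mapE [in RHS]/wcoord ffunE /= wevalX /v.
- by rewrite (unsplitK (inl i : 'I_n + 'I_(n + n))).
- rewrite (unsplitK (inr (lshift n i) : 'I_n + 'I_(n + n))) /pairv.
  by rewrite (unsplitK (inl i : 'I_n + 'I_n)).
- rewrite (unsplitK (inr (rshift n i) : 'I_n + 'I_(n + n))) /pairv.
  by rewrite (unsplitK (inr i : 'I_n + 'I_n)).
Qed.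

Section WittRing.
Variables (A : comPzRingType) (n : nat).

Let mapE := (witt_mapD, witt_mapM, witt_mapN).

Fact witt_addA : associative (@witt_add A n).
Proof.
move=> a b c; have [k [f [x [y [z [-> -> ->]]]]]] := witt_lift3 a b c.
rewrite -!mapE; congr witt_map.
by apply: ghost_inj => m mn; rewrite !(ghostD _ _ mn); apply: addrA.
Qed.

Fact witt_addC : commutative (@witt_add A n).
Proof.
move=> a b; have [k [f [x [y [z [-> -> _]]]]]] := witt_lift3 a b a.
rewrite -!mapE; congr witt_map.
by apply: ghost_inj => m mn; rewrite !(ghostD _ _ mn); apply: addrC.
Qed.

Fact witt_add0 : left_id (witt_zero A n) (@witt_add A n).
Proof.
move=> a; have [k [f [x [y [z [-> _ _]]]]]] := witt_lift3 a a a.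
rewrite -(witt_map0 f) -!mapE; congr witt_map.
by apply: ghost_inj => m mn; rewrite (ghostD _ _ mn) ghost0; apply: add0r.
Qed.

Fact witt_addN : left_inverse (witt_zero A n) (@witt_opp A n) (@witt_add A n).
Proof.
move=> a; have [k [f [x [y [z [-> _ _]]]]]] := witt_lift3 a a a.
rewrite -(witt_map0 f) -!mapE; congr witt_map.
apply: ghost_inj => m mn; rewrite (ghostD _ _ mn) (ghostN _ mn) ghost0.
by apply: addNr.
Qed.

Fact witt_mulA : associative (@witt_mul A n).
Proof.
move=> a b c; have [k [f [x [y [z [-> -> ->]]]]]] := witt_lift3 a b c.
rewrite -!mapE; congr witt_map.
by apply: ghost_inj => m mn; rewrite !(ghostM _ _ mn); apply: mulrA.
Qed.

Fact witt_mulC : commutative (@witt_mul A n).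
Proof.
move=> a b; have [k [f [x [y [z [-> -> _]]]]]] := witt_lift3 a b a.
rewrite -!mapE; congr witt_map.
by apply: ghost_inj => m mn; rewrite !(ghostM _ _ mn); apply: mulrC.
Qed.

Fact witt_mul1 : left_id (witt_one A n) (@witt_mul A n).
Proof.
move=> a; have [k [f [x [y [z [-> _ _]]]]]] := witt_lift3 a a a.
rewrite /witt_one -(rmorph1 f) -witt_map_teich -!mapE; congr witt_map.
apply: ghost_inj => m mn; rewrite (ghostM _ _ mn) (ghost1 _ mn).
by apply: mul1r.
Qed.

Fact witt_mulDl : left_distributive (@witt_mul A n) (@witt_add A n).
Proof.
move=> a b c; have [k [f [x [y [z [-> -> ->]]]]]] := witt_lift3 a b c.
rewrite -!mapE; congr witt_map.
apply: ghost_inj => m mn.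
by rewrite (ghostM _ _ mn) !(ghostD _ _ mn) !(ghostM _ _ mn); apply: mulrDl.
Qed.

HB.instance Definition _ := GRing.isZmodule.Build (witt n A)
  witt_addA witt_addC witt_add0 witt_addN.
HB.instance Definition _ := GRing.Zmodule_isComPzRing.Build (witt n A)
  witt_mulA witt_mulC witt_mul1 witt_mulDl.

Lemma teich1 : teich n (1 : A) = 1. Proof. by []. Qed.

End WittRing.

Lemma teichM (A : comPzRingType) n (a b : A) :
  teich n (a * b) = teich n a * teich n b.
Proof.
pose v (i : 'I_2) := if i == ord0 then a else b.
pose f : {rmorphism {mpoly int[2]} -> A} := weval v.
have -> : a = f 'X_(ord0 : 'I_2) by rewrite /f /= wevalX.
have -> : b = f 'X_(ord_max : 'I_2) by rewrite /f /= wevalX.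
rewrite -rmorphM -!witt_map_teich.
rewrite -[RHS](witt_mapM f); congr witt_map.
apply: ghost_inj => m mn; rewrite (ghostM _ _ mn) !(ghost_teich _ mn).
by apply: exprMn.
Qed.

Record gradedRing := GradedRing {
  graded_ring :> pzRingType;
  gr : nat -> graded_ring -> Prop;
  gr_zero : forall i, gr i 0;
  gr_sub : forall i x y, gr i x -> gr i y -> gr i (x - y);
  gr_one : gr 0 1;
  gr_mul : forall i j x y, gr i x -> gr j y -> gr (i + j) (x * y);
  gr_span : forall x, exists k (c : nat -> graded_ring),
    (forall i, gr i (c i)) /\ x = \sum_(i < k) c i;
  gr_direct : forall k (c : nat -> graded_ring),
    (forall i, gr i (c i)) -> \sum_(i < k) c i = 0 ->
    forall i, (i < k)%N -> c i = 0 }.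

Definition graded_commutative (E : gradedRing) : Prop :=
  forall i j (x y : E), gr i x -> gr j y -> x * y = (-1) ^+ (i * j) * (y * x).

Definition graded_map (E E' : gradedRing) (r : nat) (f : E -> E') : Prop :=
  forall i x, gr i x -> gr (i + r) (f x).

(* Pro-objects are indexed by nat with value 0 at 0, which is the same as being
   indexed by the integers with value 0 at all n <= 0.  Graded pieces are
   indexed by nat. *)
Record wittComplex (A : comPzRingType) := WittComplex {
  wcE :> nat -> gradedRing;
  wcE_comm : forall n, graded_commutative (wcE n);
  wcE_zero : forall x : wcE 0, x = 0;

  wcR : forall n, {rmorphism wcE n.+1 -> wcE n};
  wcR_graded : forall n, graded_map 0 (wcR n);

  wcL : forall n, {rmorphism witt n A -> wcE n};
  wcL_graded : forall n x, gr 0 (wcL n x);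
  wcL_strict : forall n x, wcR n (wcL n.+1 x) = wcL n (wittR x);

  wcF : forall n, {rmorphism wcE n.+1 -> wcE n};
  wcF_graded : forall n, graded_map 0 (wcF n);
  wcF_strict : forall n x, wcR n (wcF n.+1 x) = wcF n (wcR n.+1 x);
  wcF_L : forall n x, wcL n (wittF x) = wcF n (wcL n.+1 x);

  wcV : forall n, {additive wcE n -> wcE n.+1};
  wcV_graded : forall n, graded_map 0 (wcV n);
  wcV_strict : forall n x, wcR n.+1 (wcV n.+1 x) = wcV n (wcR n x);
  wcV_mul : forall n x y, wcV n x * y = wcV n (x * wcF n y);
  wcV_L : forall n x, wcL n.+1 (wittV x) = wcV n (wcL n x);
  wcFV : forall n x, wcF n (wcV n x) = x *+ 2;

  wcd : forall n, {additive wcE n -> wcE n};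
  wcd_graded : forall n, graded_map 1 (wcd n);
  wcd_strict : forall n x, wcR n (wcd n.+1 x) = wcd n (wcR n x);
  wcd_mul : forall n i (x y : wcE n), gr i x ->
    wcd n (x * y) = wcd n x * y + (-1) ^+ i * (x * wcd n y);

  (* iota, multiplication by d[-1] / [-1]; [-1] is its own inverse by
     [teichM] *)
  wci := fun n (x : wcE n) =>
    wcd n (wcL n (teich n (-1))) * wcL n (teich n (-1)) * x;

  wcFdV : forall n x, wcF n (wcd n.+1 (wcV n x)) = wcd n x + wci x;
  wcdd : forall n x, wcd n (wcd n x) = wcd n (wci x);
  wcdi : forall n x, wcd n (wci x) = wci (wcd n x);
  wcFd_teich : forall n (a : A),
    wcF n (wcd n.+1 (wcL n.+1 (teich n.+1 a))) =
    wcL n (teich n a) * wcd n (wcL n (teich n a)) }.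

Arguments wci {A} w n x.

Record wittMorphism (A : comPzRingType) (E E' : wittComplex A) := WittMorphism {
  wm :> forall n, {rmorphism E n -> E' n};
  wm_graded : forall n, graded_map 0 (wm n);
  wm_R : forall n x, wm n (wcR E n x) = wcR E' n (wm n.+1 x);
  wm_L : forall n x, wm n (wcL E n x) = wcL E' n x;
  wm_F : forall n x, wm n (wcF E n x) = wcF E' n (wm n.+1 x);
  wm_V : forall n x, wm n.+1 (wcV E n x) = wcV E' n (wm n x);
  wm_d : forall n x, wm n (wcd E n x) = wcd E' n (wm n x) }.

Definition is_deRhamWitt (A : comPzRingType) (E : wittComplex A) : Prop :=
  forall E' : wittComplex A, exists f : wittMorphism E E',
  forall (g : wittMorphism E E') n x, g n x = f n x.

(* V^i(1) = V^i([1]_{n-i}) in level n; it is 0 when n <= i. *)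
Fixpoint wcV1 (A : comPzRingType) (E : wittComplex A) (n i : nat) : E n :=
  match i, n with
  | 0, n => wcL E n (teich n 1)
  | i.+1, n.+1 => wcV E n (wcV1 E n i)
  | _.+1, 0 => 0
  end.

Definition wcdV1 (A : comPzRingType) (E : wittComplex A) (n i : nat) : E n :=
  wcd E n (wcV1 E n i).

(* The subgroup H of M is the internal direct sum of the cyclic subgroups
   generated by the g i for a <= i < b, and g i has order exactly o i, where
   o i = 0 stands for infinite order. *)
Definition is_cyclic_dsum (M : zmodType) (H : M -> Prop) (a b : nat)
    (g : nat -> M) (o : nat -> nat) : Prop :=
  [/\ forall x, H x <-> exists c : nat -> int, x = \sum_(a <= i < b) g i *~ c i,
      forall c : nat -> int, \sum_(a <= i < b) g i *~ c i = 0 ->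
        forall i, (a <= i < b)%N -> g i *~ c i = 0
    & forall i, (a <= i < b)%N ->
        forall c : int, g i *~ c = 0 <-> (o i %| c)%Z].

(* Main.v *)
Require Import Defs.
From HB Require Import structures.
From mathcomp Require Import all_boot all_order all_algebra.
From mathcomp Require Import ring zify.

(* Let M_n be the square-zero extension of W_n(Z) by T_n = \bigoplus_s Z/2^s,
   with the s-th generator playing the role of dV^s(1).  Write c_i(x) for the
   coordinates of x in W_n(Z) along the V^i(1), w_s(x) for its ghost components
   and A_s(b) = \sum_(1 <= i < s) b_i.  The formulas of the theorem amount to
     (x b)_s = w_(s-1)(x) b_s + 2^(s-1) A_s(c(x)) A_s(b),
     F(b)_s = b_(s+1) + 2^(s-1) A_(s+1)(b),   V(b)_(s+1) = 2 b_s,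
     d(x)_s = c_s(x),
   and congruences between ghost components show that M is a Witt complex.
   Conversely the formulas hold in every Witt complex E over Z: with
   eta = dlog[-1], one has F(eta) = eta, 2 eta = 0, V d = 2 d V and
   [-1] = V(1) - 1, which gives eta = dV(1) + V(eta) and hence
   eta = \sum_s 2^(s-1) dV^s(1); the products V^i(1) dV^j(1) follow by induction
   from V(x) dV(y) = V(x (dy + eta y)), and dV^i(1) dV^j(1) = 0 on applying d
   to them.  So there is a morphism M -> E; for E initial, its composite with
   E -> M is the identity of E, and E -> M detects the orders of the
   generators. *)

Set Implicit Arguments.
Unset Strict Implicit.
Unset Printing Implicit Defensive.

Import GRing.Theory Num.Theory.

Local Open Scope ring_scope.
Local Open Scope quotient_scope.

(** * Witt vectors of the integers *)

Lemma dvdz2_sqrB (a : int) : (2 %| a ^+ 2 - a)%Z.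
Proof.
have /dvdzP[q qE] : (2 %| a - (a %% 2)%Z)%Z.
  by rewrite {1}(divz_eq a 2) addrK dvdz_mull.
have := modz_ge0 a (isT : (2 : int) != 0).
have := ltz_pmod a (isT : 0 < (2 : int)).
have -> : a = q * 2 + (a %% 2)%Z by rewrite -qE subrK.
rewrite modzMDl modz_mod; case: (a %% 2)%Z => // -[|[|//]] _ _.
  by apply/dvdzP; exists (q ^+ 2 * 2 - q); ring.
by apply/dvdzP; exists (q ^+ 2 * 2 + q); ring.
Qed.

(** Euler's congruence: with u = a^(2^k), squaring u^2 = u + 2^(k+1) q gains one factor 2. *)
Lemma dvdz_expr2X (a : int) k :
  (2 ^+ k.+1 %| a ^+ (2 ^ k.+1) - a ^+ (2 ^ k))%Z.
Proof.
elim: k => [|k IHk]; first by rewrite expr1 dvdz2_sqrB.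
rewrite (expnSr _ k.+1) exprM; have := IHk; rewrite (expnSr _ k) exprM.
set u := a ^+ (2 ^ k) => /dvdzP[q /eqP]; rewrite subr_eq => /eqP uE.
apply/dvdzP; exists (q * u + 2 ^+ k * q ^+ 2).
by rewrite {1}uE !exprS; ring.
Qed.

Lemma dvdz_sum (I : Type) (r : seq I) (P : pred I) (F : I -> int) (d : int) :
  (forall i, P i -> (d %| F i)%Z) -> (d %| \sum_(i <- r | P i) F i)%Z.
Proof.
move=> dF; elim/big_ind: _ => [|a b|//]; [exact: dvdz0 | exact: rpredD].
Qed.

(** * Ghost components and V-coordinates of integral Witt vectors *)

Section GhostInt.
Variable n : nat.
Implicit Types x y : witt n int.

(** Dwork's congruence, with the identity of Z as Frobenius lift: each term with i <= m is 2^i times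
    an instance of [dvdz_expr2X], and the new term carries 2^(m+1). *)
Lemma dvdz_ghostB (x : 'I_n -> int) m :
  (2 ^+ m.+1 %| ghost x m.+1 - ghost x m)%Z.
Proof.
rewrite /ghost [X in X - _]big_mkcond [X in _ - X]big_mkcond -sumrB.
apply: dvdz_sum => i _; case: (ltngtP i m.+1) => [im|im|->].
- rewrite -ltnS im subSn // -mulrnBl -[_ *+ 2 ^ i]mulr_natl natrX.
  have -> : 2 ^+ m.+1 = 2 ^+ i * 2 ^+ (m - i).+1 :> int.
    by rewrite -exprD addnS subnKC.
  by apply: dvdz_mul (dvdzz _) (dvdz_expr2X _ _).
- by rewrite leqNgt (ltn_trans _ im) ?subr0 ?dvdz0.
- by rewrite ltnn subr0 -[_ *+ 2 ^ _]mulr_natl natrX dvdz_mulr.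
Qed.

Lemma ghost_int_inj x y :
  (forall m, (m < n)%N -> ghost x m = ghost y m) -> x = y.
Proof.
move=> xy; apply: wittP; case; elim/ltn_ind => m IHm mn.
have := xy m mn; rewrite /ghost.
rewrite (bigD1 (Ordinal mn)) //= [RHS](bigD1 (Ordinal mn)) //=.
rewrite (eq_bigr (fun i => y i ^+ (2 ^ (m - i)) *+ 2 ^ i)).
  move/addIr; rewrite subnn !expr1 => /eqP.
  by rewrite eqrMn2r expn_eq0 => /= /eqP.
case=> i lt_in /andP[/= im inm]; rewrite IHm // ltn_neqAle im andbT.
by apply: contraNneq inm => eim; apply/eqP/val_inj.
Qed.

(* The coefficient of V^s(1) in the expansion [witt_expand]. *)
Definition vcoord x (s : nat) : int :=
  if s is s'.+1 then ((ghost x s - ghost x s') %/ 2 ^+ s)%Z else ghost x 0.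

Lemma ghostS x s : ghost x s.+1 = ghost x s + vcoord x s.+1 * 2 ^+ s.+1.
Proof. by rewrite /= divzK ?dvdz_ghostB // addrC subrK. Qed.

(** A division-free characterisation, which reduces formulas for [vcoord] to polynomial identities
    between ghost components. *)
Lemma vcoordP x s (a : int) :
  ghost x s.+1 = ghost x s + a * 2 ^+ s.+1 -> vcoord x s.+1 = a.
Proof.
by rewrite ghostS => /addrI /mulIf; apply; rewrite expf_eq0.
Qed.

Lemma ghost_vcoord x m : ghost x m = \sum_(i < m.+1) vcoord x i * 2 ^+ i.
Proof.
elim: m => [|m IHm]; first by rewrite big_ord1 expr0 mulr1.
by rewrite big_ord_recr -IHm; apply: ghostS.
Qed.

Lemma vcoord_inj x y :
  (forall s, (s < n)%N -> vcoord x s = vcoord y s) -> x = y.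
Proof.
move=> xy; apply: ghost_int_inj => m mn; rewrite !ghost_vcoord.
by apply: eq_bigr => i _; rewrite xy // (leq_trans (ltn_ord i)).
Qed.

Lemma ghostB_int x y m : (m < n)%N -> ghost (x - y) m = ghost x m - ghost y m.
Proof. by move=> mn; rewrite (ghostD _ _ mn) (ghostN _ mn). Qed.

Lemma vcoordB x y s : (s < n)%N -> vcoord (x - y) s = vcoord x s - vcoord y s.
Proof.
case: s => [|s] sn; first by rewrite /= ghostB_int.
apply: vcoordP; rewrite !ghostB_int ?(ltnW sn) // !(ghostS _ s); ring.
Qed.

Lemma vcoord0 s : vcoord 0 s = 0.
Proof.
case: s => [|s]; first exact: ghost0.
by apply: vcoordP; rewrite !ghost0 mul0r addr0.
Qed.

Lemma vcoordD x y s : (s < n)%N -> vcoord (x + y) s = vcoord x s + vcoord y s.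
Proof.
by move=> sn; rewrite -{2}[x](addrK y) vcoordB // subrK.
Qed.

Lemma vcoordM x y s : (s.+1 < n)%N ->
  vcoord (x * y) s.+1 = ghost x s * vcoord y s.+1 + ghost y s * vcoord x s.+1 +
    2 ^+ s.+1 * vcoord x s.+1 * vcoord y s.+1.
Proof.
by move=> sn; apply: vcoordP; rewrite !ghostM ?(ltnW sn) // !(ghostS _ s); ring.
Qed.

Lemma vcoord1 s : (s < n)%N -> vcoord 1 s = (s == 0%N)%:R.
Proof.
case: s => [|s] sn; first exact: ghost1.
by apply: vcoordP; rewrite !ghost1 ?(ltnW sn) // mul0r addr0.
Qed.

End GhostInt.

(** * Restriction, Frobenius and Verschiebung on W_n(Z) *)

Lemma vcoord_R n (x : witt n.+1 int) s :
  (s < n)%N -> vcoord (wittR x) s = vcoord x s.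
Proof.
case: s => [|s] sn; first exact: ghostR.
by apply: vcoordP; rewrite !ghostR ?(ltnW sn) // ghostS.
Qed.

Lemma ghostV0 n (x : witt n int) : ghost (wittV x) 0 = 0.
Proof.
rewrite /ghost big1 // => i; rewrite leqn0 => /eqP i0.
have -> : i = ord0 by apply: val_inj.
by rewrite /wcoord ffunE unlift_none expr0n.
Qed.

Lemma vcoord_VS n (x : witt n int) s :
  (s < n)%N -> vcoord (wittV x) s.+1 = vcoord x s.
Proof.
move=> sn; apply: vcoordP; rewrite ghostV //.
case: s sn => [|s] sn; first by rewrite ghostV0 mulr2n /=; ring.
by rewrite ghostV ?(ltnW sn) // ghostS !exprS; ring.
Qed.

Lemma vcoord_FS n (x : witt n.+1 int) s :
  (s.+1 < n)%N -> vcoord (wittF x) s.+1 = vcoord x s.+2 * 2.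
Proof.
move=> sn; apply: vcoordP; rewrite !ghostF ?(ltnW sn) //.
by rewrite ghostS (exprS _ s.+1); ring.
Qed.

Fact wittR_is_zmod_morphism n : zmod_morphism (@wittR int n).
Proof.
move=> x y; apply: ghost_int_inj => m mn.
by rewrite ghostB_int // !ghostR // ghostB_int // ltnW.
Qed.

Fact wittR_is_monoid_morphism n : monoid_morphism (@wittR int n).
Proof.
split=> [|x y]; apply: ghost_int_inj => m mn.
  by rewrite ghostR // !ghost1 // ltnW.
by rewrite ghostM // !ghostR // ghostM // ltnW.
Qed.

HB.instance Definition _ n := GRing.isZmodMorphism.Build
  (witt n.+1 int) (witt n int) (@wittR int n) (@wittR_is_zmod_morphism n).
HB.instance Definition _ n := GRing.isMonoidMorphism.Build
  (witt n.+1 int) (witt n int) (@wittR int n) (@wittR_is_monoid_morphism n).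

Fact wittF_is_zmod_morphism n : zmod_morphism (@wittF int n).
Proof.
move=> x y; apply: ghost_int_inj => m mn.
by rewrite ghostB_int // !ghostF // ghostB_int.
Qed.

Fact wittF_is_monoid_morphism n : monoid_morphism (@wittF int n).
Proof.
split=> [|x y]; apply: ghost_int_inj => m mn.
  by rewrite ghostF // !ghost1.
by rewrite ghostM // !ghostF // ghostM.
Qed.

HB.instance Definition _ n := GRing.isZmodMorphism.Build
  (witt n.+1 int) (witt n int) (@wittF int n) (@wittF_is_zmod_morphism n).
HB.instance Definition _ n := GRing.isMonoidMorphism.Build
  (witt n.+1 int) (witt n int) (@wittF int n) (@wittF_is_monoid_morphism n).

Fact wittV_is_zmod_morphism n : zmod_morphism (@wittV int n).
Proof.
move=> x y; apply: ghost_int_inj => -[|m] mn; rewrite ghostB_int //.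
  by rewrite !ghostV0 subr0.
by rewrite !ghostV // ghostB_int // mulrnBl.
Qed.

HB.instance Definition _ n := GRing.isZmodMorphism.Build
  (witt n int) (witt n.+1 int) (@wittV int n) (@wittV_is_zmod_morphism n).

Lemma wittVM n (x : witt n int) y : wittV x * y = wittV (x * wittF y).
Proof.
apply: ghost_int_inj => -[|m] mn; rewrite ghostM //.
  by rewrite !ghostV0 mul0r.
by rewrite !ghostV // ghostM // ghostF // mulrnAl.
Qed.

Lemma wittFV n (x : witt n int) : wittF (wittV x) = x *+ 2.
Proof.
by apply: ghost_int_inj => m mn; rewrite ghostF // ghostV // !mulr2n ghostD.
Qed.

Lemma wittRF n (x : witt n.+2 int) : wittR (wittF x) = wittF (wittR x).
Proof.
apply: ghost_int_inj => m mn.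
by rewrite ghostR // !ghostF ?ghostR // ltnW.
Qed.

Lemma wittRV n (x : witt n.+1 int) : wittR (wittV x) = wittV (wittR x).
Proof.
apply: ghost_int_inj => -[|m] mn; rewrite ghostR // ?ghostV0 //.
by rewrite !ghostV ?ghostR // ltnW.
Qed.

Fixpoint wittV1 (n i : nat) {struct i} : witt n int :=
  match i, n with
  | 0, n => 1
  | i.+1, n.+1 => wittV (wittV1 n i)
  | _.+1, 0 => 0
  end.

Lemma vcoord_V1 n i s : (s < n)%N -> vcoord (wittV1 n i) s = (s == i)%:R.
Proof.
elim: i n s => [|i IHi] n s; first exact: vcoord1.
case: n => // n; case: s => [|s] sn /=; first by rewrite ghostV0.
by rewrite -/(vcoord _ s.+1) vcoord_VS // IHi.
Qed.

Lemma wittV1_ge n i : (n <= i)%N -> wittV1 n i = 0.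
Proof.
move=> ni; apply: vcoord_inj => s sn.
by rewrite vcoord_V1 // vcoord0 (ltn_eqF (leq_trans sn ni)).
Qed.

Lemma vcoord_sum n m (F : nat -> witt n int) s : (s < n)%N ->
  vcoord (\sum_(i < m) F i) s = \sum_(i < m) vcoord (F i) s.
Proof.
move=> sn; elim: m => [|m IHm]; first by rewrite !big_ord0 vcoord0.
by rewrite !big_ord_recr vcoordD // IHm.
Qed.

Lemma vcoordMz n (x : witt n int) c s :
  (s < n)%N -> vcoord (x *~ c) s = vcoord x s *~ c.
Proof.
move=> sn; have vcoordMn k : vcoord (x *+ k) s = vcoord x s *+ k.
  elim: k => [|k IHk]; first by rewrite !mulr0n vcoord0.
  by rewrite !mulrS vcoordD // IHk.
case: c => k; first exact: vcoordMn.
by rewrite NegzE !mulrNz -!pmulrn -sub0r vcoordB // vcoordMn vcoord0 sub0r.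
Qed.

Lemma vcoord_comb n (c : nat -> int) s : (s < n)%N ->
  vcoord (\sum_(i < n) wittV1 n i *~ c i) s = c s.
Proof.
move=> sn; rewrite (vcoord_sum _ (fun i => wittV1 n i *~ c i)) //.
rewrite (bigD1 (Ordinal sn)) //= big1 => [|i].
  by rewrite vcoordMz // vcoord_V1 // eqxx addr0 intz.
rewrite -val_eqE eq_sym => /negbTE /= i_s.
by rewrite vcoordMz // vcoord_V1 // i_s mul0rz.
Qed.

Lemma witt_expand n (x : witt n int) :
  x = \sum_(i < n) wittV1 n i *~ vcoord x i.
Proof. by apply: vcoord_inj => s sn; rewrite vcoord_comb. Qed.

Lemma wittV1_mulr n i j :
  (i <= j)%N -> wittV1 n i * wittV1 n j = wittV1 n j *+ 2 ^ i.
Proof.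
elim: i j n => [|i IHi] [|j] [|n] ij //=; rewrite ?mul1r ?mulr1n ?mul0r ?mul0rn //.
by rewrite wittVM wittFV mulrnAr IHi // -mulrnA raddfMn -expnSr.
Qed.

(** In ghost components, (-1, 1, 1, ...) = (0, 2, 2, ...) - (1, 1, 1, ...). *)
Lemma teichN1 n : teich n.+1 (-1) = wittV1 n.+1 1 - 1 :> witt n.+1 int.
Proof.
apply: ghost_int_inj => m mn; rewrite ghostB_int // ghost_teich // ghost1 //.
case: m mn => [|m] mn /=; first by rewrite ghostV0.
by rewrite ghostV // ghost1 // expnS exprM sqrrN !expr1n.
Qed.

(** * The module of 1-forms *)

(** In the coordinate s of a 1-form this sum comes with the factor 2^(s-1) and counts modulo 2^s, so
    only its parity matters; hence the statements up to [2 * k] below. *)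
Definition psum (a : nat -> int) (s : nat) : int := \sum_(1 <= i < s) a i.

Lemma psum1 a : psum a 1 = 0. Proof. by rewrite /psum big_geq. Qed.

Lemma psumS a s : psum a s.+2 = psum a s.+1 + a s.+1.
Proof. by rewrite /psum big_nat_recr. Qed.

Lemma eq_psum a b s :
  (forall i, (i.+1 < s)%N -> a i.+1 = b i.+1) -> psum a s = psum b s.
Proof. by move=> ab; apply: eq_big_nat => -[|i] //= /ab. Qed.

Lemma psumB a b s : psum (fun i => a i - b i) s = psum a s - psum b s.
Proof. exact: sumrB. Qed.

Lemma psum_lin c d a b s :
  psum (fun i => c * a i + d * b i) s = c * psum a s + d * psum b s.
Proof. by rewrite /psum big_split /= -!mulr_sumr. Qed.

Lemma dvdz2_psum a s :
  (forall i, (i.+1 < s)%N -> (2 %| a i.+1)%Z) -> (2 %| psum a s)%Z.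
Proof.
move=> a2; rewrite /psum big_seq; apply: dvdz_sum => -[|i].
  by rewrite mem_index_iota.
by rewrite mem_index_iota => /andP[_ /a2].
Qed.

Lemma psum_mod2 a b s :
  (forall i, (i.+1 < s)%N -> (2 %| a i.+1 - b i.+1)%Z) ->
  exists k, psum a s = psum b s + 2 * k.
Proof.
move=> ab; have := @dvdz2_psum (fun i => a i - b i) s ab.
rewrite psumB => /dvdzP[k /eqP]; rewrite subr_eq => /eqP ->.
by exists k; ring.
Qed.

Lemma psum_poly n (E : nat -> int) s : (s <= n)%N ->
  psum (fun i => (\poly_(j < n) E j)`_i) s = psum E s.
Proof.
by move=> sn; apply: eq_psum => i i_s; rewrite coef_poly (leq_trans i_s).
Qed.

Lemma ghost_mod2 n (x : 'I_n -> int) s : exists k, ghost x s = ghost x 0 + 2 * k.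
Proof.
elim: s => [|s [k IHs]]; first by exists 0; rewrite mulr0 addr0.
have /dvdzP[q /eqP] := dvdz_ghostB x s.
rewrite subr_eq IHs => /eqP ->; exists (k + q * 2 ^+ s).
by rewrite exprS; ring.
Qed.

(** Modulo 2 all ghost components agree with w_0 and the quadratic term of [vcoordM] vanishes, so
    each positive coordinate obeys a Leibniz rule, and so do the partial sums. *)
Lemma psum_vcoordM n (x y : witt n int) s : (s <= n)%N ->
  exists k, psum (vcoord (x * y)) s =
    ghost x 0 * psum (vcoord y) s + ghost y 0 * psum (vcoord x) s + 2 * k.
Proof.
move=> sn; rewrite -psum_lin; apply: psum_mod2 => i i_s.
rewrite vcoordM ?(leq_trans i_s) //.
have [k ->] := ghost_mod2 x i; have [l ->] := ghost_mod2 y i.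
set a := vcoord x _; set b := vcoord y _.
by apply/dvdzP; exists (k * b + l * a + 2 ^+ i * a * b); rewrite exprS; ring.
Qed.

(* The 1-form \sum_s p_s dV^s(1) of level n is represented by p, the index 0
   contributing nothing since 2 ^ 0 = 1. *)
Definition null_form n : {pred {poly int}} :=
  fun p => [forall s : 'I_n, (2 ^+ s %| p`_s)%Z].

Lemma null_formP n (p : {poly int}) :
  reflect (forall s, (s.+1 < n)%N -> (2 ^+ s.+1 %| p`_s.+1)%Z)
          (p \in null_form n).
Proof.
apply: (iffP forallP) => [pn s sn|pn [[|s] sn]]; first exact: (pn (Ordinal sn)).
  by rewrite expr0 dvd1z.
exact: pn.
Qed.

Fact null_form_closed n : zmod_closed (null_form n).
Proof.
split=> [|p q /null_formP pn /null_formP qn]; apply/null_formP => s sn.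
  by rewrite coef0 dvdz0.
by rewrite coefB rpredB ?pn ?qn.
Qed.

HB.instance Definition _ n :=
  GRing.isZmodClosed.Build {poly int} (null_form n) (null_form_closed n).

Notation wform n := (Quotient.quot (null_form n)).

Lemma form_eqP n (p q : {poly int}) :
  \pi_(wform n) p = \pi_(wform n) q <->
  (forall s, (s.+1 < n)%N -> (2 ^+ s.+1 %| p`_s.+1 - q`_s.+1)%Z).
Proof.
split=> [/eqP|pq].
  rewrite -Quotient.idealrBE => /null_formP pq s sn.
  by rewrite -coefB pq.
apply/eqP; rewrite -Quotient.idealrBE; apply/null_formP => s sn.
by rewrite coefB pq.
Qed.

Lemma form_ind n (P : wform n -> Prop) :
  (forall p, P (\pi_(wform n) p)) -> forall t, P t.
Proof. by move=> Ppi t; rewrite -[t]reprK. Qed.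

(** Applied to the canonical representative; [form_compat] is the condition under which any other
    representative gives the same result. *)
Definition form_lift n m (h : {poly int} -> {poly int}) (t : wform n) : wform m :=
  \pi_(wform m) (h (repr t)).

Definition form_compat n m (h : {poly int} -> {poly int}) :=
  forall p q : {poly int},
  (forall s, (s.+1 < n)%N -> (2 ^+ s.+1 %| p`_s.+1 - q`_s.+1)%Z) ->
  forall s, (s.+1 < m)%N -> (2 ^+ s.+1 %| (h p)`_s.+1 - (h q)`_s.+1)%Z.

Lemma form_liftE n m h p : form_compat n m h ->
  form_lift m h (\pi_(wform n) p) = \pi_(wform m) (h p).
Proof.
by move=> hn; apply/form_eqP/hn/form_eqP; rewrite reprK.
Qed.

Lemma psum_null n (p q : {poly int}) s : (s <= n)%N ->
  (forall s, (s.+1 < n)%N -> (2 ^+ s.+1 %| p`_s.+1 - q`_s.+1)%Z) ->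
  exists k, psum (nth 0 p) s = psum (nth 0 q) s + 2 * k.
Proof.
move=> sn pq; apply: psum_mod2 => i i_s; apply: dvdz_trans (pq i _).
  by rewrite exprS dvdz_mulr.
exact: leq_trans sn.
Qed.

Lemma psum_coefB (p q : {poly int}) s :
  psum (nth 0 (p - q)) s = psum (nth 0 p) s - psum (nth 0 q) s.
Proof. by rewrite -psumB; apply: eq_psum => i _; rewrite coefB. Qed.

(** The product formula for x b on coefficients. At the index 0, where [s.-1] is truncated, the
    value is arbitrary since the quotient ignores it. *)
Definition act_rep n (x : witt n int) (p : {poly int}) : {poly int} :=
  \poly_(s < n) (ghost x s.-1 * p`_s +
    2 ^+ s.-1 * psum (vcoord x) s * psum (nth 0 p) s).

Definition F_rep n (p : {poly int}) : {poly int} :=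
  \poly_(s < n) (p`_s.+1 + 2 ^+ s.-1 * psum (nth 0 p) s.+1).

Definition V_rep (p : {poly int}) : {poly int} := 'X * p *+ 2.

Definition d_rep n (x : witt n int) : {poly int} := \poly_(s < n) vcoord x s.

(** * Compatibility with the quotient, and parities of partial sums *)

Section Reps.
Variable n : nat.
Implicit Types (x y : witt n int) (p q : {poly int}).

Lemma act_repE x p s : (s.+1 < n)%N -> (act_rep x p)`_s.+1 =
  ghost x s * p`_s.+1 + 2 ^+ s * psum (vcoord x) s.+1 * psum (nth 0 p) s.+1.
Proof. by move=> sn; rewrite coef_poly sn. Qed.

Lemma F_repE p s : (s.+1 < n)%N ->
  (F_rep n p)`_s.+1 = p`_s.+2 + 2 ^+ s * psum (nth 0 p) s.+2.
Proof. by move=> sn; rewrite coef_poly sn. Qed.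

Lemma V_repE p s : (V_rep p)`_s.+1 = 2 * p`_s.
Proof. by rewrite coefMn coefXM mulr2n /=; ring. Qed.

Lemma d_repE x s : (s < n)%N -> (d_rep x)`_s = vcoord x s.
Proof. by move=> sn; rewrite coef_poly sn. Qed.

Lemma act_compat x : form_compat n n (act_rep x).
Proof.
move=> p q pq s sn; have [k kE] := psum_null (ltnW sn) pq.
rewrite !act_repE // kE; have /dvdzP[l lE] := pq s sn.
have -> : p`_s.+1 = q`_s.+1 + l * 2 ^+ s.+1 by rewrite -lE; ring.
apply/dvdzP; exists (ghost x s * l + psum (vcoord x) s.+1 * k).
by rewrite exprS; ring.
Qed.

Lemma F_compat : form_compat n.+1 n (F_rep n).
Proof.
move=> p q pq s sn; have [k kE] := @psum_null n.+1 p q s.+2 (leqW sn) pq.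
rewrite !F_repE // kE; have /dvdzP[l lE] := pq s.+1 sn.
have -> : p`_s.+2 = q`_s.+2 + l * 2 ^+ s.+2 by rewrite -lE; ring.
by apply/dvdzP; exists (l * 2 + k); rewrite !exprS; ring.
Qed.

Lemma V_compat : form_compat n n.+1 V_rep.
Proof.
move=> p q pq s; rewrite ltnS !V_repE => sn.
(* The index 1 receives twice the unconstrained constant coefficient, which is harmless because the
   modulus there is 2. *)
case: s sn => [|s] sn; first by apply/dvdzP; exists (p`_0 - q`_0); ring.
have /dvdzP[l lE] := pq s sn; apply/dvdzP; exists l.
by rewrite -mulrBr lE !exprS; ring.
Qed.

Lemma id_compat : form_compat n.+1 n id.
Proof. by move=> p q pq s sn; apply: pq; apply: ltnW. Qed.

Lemma psum_act x p s : (s <= n)%N ->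
  exists k, psum (nth 0 (act_rep x p)) s = ghost x 0 * psum (nth 0 p) s + 2 * k.
Proof.
have -> : ghost x 0 * psum (nth 0 p) s =
    psum (fun i => ghost x 0 * p`_i + 0 * 0) s by rewrite psum_lin mul0r addr0.
move=> sn; apply: psum_mod2 => i i_s; rewrite act_repE ?(leq_trans i_s) //.
(* For i = 0 the factor 2^i is odd, but the partial sums next to it are empty. *)
have [k ->] := ghost_mod2 x i; case: i i_s => [|i] i_s.
  by rewrite psum1; apply/dvdzP; exists (k * p`_1); ring.
apply/dvdzP; set c := psum _ _; set c' := psum _ _.
by exists (k * p`_i.+2 + 2 ^+ i * c * c'); rewrite exprS; ring.
Qed.

(** F(b)_1 = b_2 + A_2(b) = b_1 + b_2 supplies the term b_1 lost by the shift, and from the index 2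
    on the correction in F(b) is even. For s = 0 the left sum is empty while the right one is
    b_1. *)
Lemma psum_F p s : (0 < s < n)%N ->
  exists k, psum (nth 0 (F_rep n p)) s.+1 = psum (nth 0 p) s.+2 + 2 * k.
Proof.
case: s => // s; elim: s => [|s IHs] sn; rewrite psumS F_repE //.
  by exists 0; rewrite !psumS psum1 expr0; ring.
have [k ->] := IHs (ltnW sn); rewrite [psum _ s.+4]psumS.
by set c := psum _ _; exists (k + 2 ^+ s * c); rewrite exprS; ring.
Qed.

Lemma psum_V p s : exists k, psum (nth 0 (V_rep p)) s = 2 * k.
Proof.
have [k ->] : exists k, psum (nth 0 (V_rep p)) s = psum (fun=> 0) s + 2 * k.
  by apply: psum_mod2 => i _; rewrite V_repE subr0 dvdz_mulr.
by exists k; rewrite /psum big1 ?add0r.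
Qed.

Lemma psum_d x s : (s <= n)%N -> psum (nth 0 (d_rep x)) s = psum (vcoord x) s.
Proof. exact: psum_poly. Qed.

End Reps.

Definition form_act n (x : witt n int) : wform n -> wform n :=
  form_lift n (act_rep x).
Definition form_R n : wform n.+1 -> wform n := form_lift n id.
Definition form_F n : wform n.+1 -> wform n := form_lift n (F_rep n).
Definition form_V n : wform n -> wform n.+1 := form_lift n.+1 V_rep.
Definition form_d n (x : witt n int) : wform n := \pi_(wform n) (d_rep x).

Lemma form_actE n (x : witt n int) p :
  form_act x (\pi_(wform n) p) = \pi_(wform n) (act_rep x p).
Proof. exact/form_liftE/act_compat. Qed.
Lemma form_RE n p : form_R (\pi_(wform n.+1) p) = \pi_(wform n) p.
Proof. exact/form_liftE/id_compat. Qed.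
Lemma form_FE n p : form_F (\pi_(wform n.+1) p) = \pi_(wform n) (F_rep n p).
Proof. exact/form_liftE/F_compat. Qed.
Lemma form_VE n p : form_V (\pi_(wform n) p) = \pi_(wform n.+1) (V_rep p).
Proof. exact/form_liftE/V_compat. Qed.

Definition formE := (form_actE, form_RE, form_FE, form_VE).

Lemma form_eq n (p q : {poly int}) :
  (forall s, (s.+1 < n)%N -> p`_s.+1 = q`_s.+1) ->
  \pi_(wform n) p = \pi_(wform n) q.
Proof. by move=> pq; apply/form_eqP => s sn; rewrite pq // subrr dvdz0. Qed.

(** * The W_n(Z)-module of 1-forms and its derivation *)

Section FormModule.
Variable n : nat.
Implicit Types (x y : witt n int) (t u : wform n).

Fact form_act_is_zmod_morphism x : zmod_morphism (form_act x).
Proof.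
elim/form_ind=> p; elim/form_ind=> q; rewrite -raddfB !formE -raddfB.
by apply: form_eq => s sn; rewrite coefB !act_repE // psum_coefB coefB; ring.
Qed.

HB.instance Definition _ x := GRing.isZmodMorphism.Build
  (wform n) (wform n) (form_act x) (form_act_is_zmod_morphism x).

Lemma form_actBl x y t : form_act (x - y) t = form_act x t - form_act y t.
Proof.
elim/form_ind: t => p; rewrite !formE -raddfB.
apply: form_eq => s sn; rewrite coefB !act_repE // ghostB_int ?(ltnW sn) //.
rewrite (_ : psum _ _ = psum (vcoord x) s.+1 - psum (vcoord y) s.+1); first ring.
rewrite -psumB; apply: eq_psum => i i_s; apply: vcoordB.
exact: ltn_trans i_s sn.
Qed.

Lemma form_actDl x y t : form_act (x + y) t = form_act x t + form_act y t.
Proof. by rewrite -{2}[x](addrK y) form_actBl subrK. Qed.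

Lemma form_act1 t : form_act 1 t = t.
Proof.
elim/form_ind: t => p; rewrite formE; apply: form_eq => s sn.
rewrite act_repE // ghost1 ?(ltnW sn) // [X in _ * X * _]big_nat big1 => [|i].
  by ring.
case: i => // i i_s; rewrite vcoord1 //; exact: ltn_trans i_s sn.
Qed.

(** Once w_s(x) w_s(y) b is cancelled, everything carries 2^s, and the two sides agree because
    modulo 2 one has A(xy) = w_0(x) A(y) + w_0(y) A(x) and A(y b) = w_0(y) A(b). *)
Lemma form_actM x y t : form_act (x * y) t = form_act x (form_act y t).
Proof.
elim/form_ind: t => p; rewrite !formE; apply/form_eqP => s sn.
rewrite !act_repE // ghostM ?(ltnW sn) //.
have [k ->] := psum_vcoordM x y (ltnW sn).
have [l ->] := psum_act y p (ltnW sn); have [m ->] := ghost_mod2 x s.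
set a := psum (vcoord x) _; set b := psum (vcoord y) _; set c := psum _ _.
by apply/dvdzP; exists (k * c - m * b * c - l * a); rewrite exprS; ring.
Qed.

(** The cross term 2^s A(x) A(y) occurs twice, so it vanishes modulo 2^(s+1), as does the quadratic
    term of [vcoordM]. *)
Lemma form_act_d x y :
  form_d (x * y) = form_act x (form_d y) + form_act y (form_d x).
Proof.
rewrite !formE -raddfD; apply/form_eqP => s sn.
rewrite coefD !act_repE // !d_repE // !psum_d ?(ltnW sn) // vcoordM //.
set a := psum _ _; set b := psum _ _; set u := vcoord x _; set v := vcoord y _.
by apply/dvdzP; exists (u * v - a * b); rewrite exprS; ring.
Qed.

Fact form_d_is_zmod_morphism : zmod_morphism (@form_d n).
Proof.
move=> x y; rewrite -raddfB; apply: form_eq => s sn.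
by rewrite coefB !d_repE ?vcoordB.
Qed.

HB.instance Definition _ := GRing.isZmodMorphism.Build
  (witt n int) (wform n) (@form_d n) form_d_is_zmod_morphism.

End FormModule.

(** * Restriction, Frobenius and Verschiebung on 1-forms *)

Section FormMaps.
Variable n : nat.

Fact form_R_is_zmod_morphism : zmod_morphism (@form_R n).
Proof.
by elim/form_ind=> p; elim/form_ind=> q; rewrite -raddfB !formE -raddfB.
Qed.

HB.instance Definition _ := GRing.isZmodMorphism.Build
  (wform n.+1) (wform n) (@form_R n) form_R_is_zmod_morphism.

Fact form_F_is_zmod_morphism : zmod_morphism (@form_F n).
Proof.
elim/form_ind=> p; elim/form_ind=> q; rewrite -raddfB !formE -raddfB.
by apply: form_eq => s sn; rewrite coefB !F_repE // psum_coefB coefB; ring.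
Qed.

HB.instance Definition _ := GRing.isZmodMorphism.Build
  (wform n.+1) (wform n) (@form_F n) form_F_is_zmod_morphism.

Fact form_V_is_zmod_morphism : zmod_morphism (@form_V n).
Proof.
elim/form_ind=> p; elim/form_ind=> q; rewrite -raddfB !formE -raddfB.
by apply: form_eq => s sn; rewrite coefB !V_repE coefB; ring.
Qed.

HB.instance Definition _ := GRing.isZmodMorphism.Build
  (wform n) (wform n.+1) (@form_V n) form_V_is_zmod_morphism.

Lemma form_R_act (x : witt n.+1 int) t :
  form_R (form_act x t) = form_act (wittR x) (form_R t).
Proof.
elim/form_ind: t => p; rewrite !formE; apply: form_eq => s sn.
rewrite !act_repE ?ghostR ?(ltnW sn) ?(leqW sn) //; congr (_ + _ * _ * _).
apply: eq_psum => i i_s; rewrite vcoord_R //; exact: ltn_trans i_s sn.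
Qed.

Lemma form_R_d (x : witt n.+1 int) : form_R (form_d x) = form_d (wittR x).
Proof.
by rewrite formE; apply: form_eq => s sn; rewrite !d_repE ?vcoord_R // ltnW.
Qed.

Lemma psum_wittF (x : witt n.+1 int) s : (s <= n)%N ->
  exists k, psum (vcoord (wittF x)) s = 2 * k.
Proof.
move=> sn; have [k ->] : exists k,
    psum (vcoord (wittF x)) s = psum (fun=> 0) s + 2 * k.
  apply: psum_mod2 => i i_s.
  by rewrite vcoord_FS ?(leq_trans i_s) // subr0 dvdz_mull.
by exists k; rewrite /psum big1 ?add0r.
Qed.

(** The corrections all carry 2^s, and modulo 2 the sum A(F(x)) vanishes while A(x b) = w_0(x)
    A(b). *)
Lemma form_F_act (x : witt n.+1 int) t :
  form_F (form_act x t) = form_act (wittF x) (form_F t).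
Proof.
elim/form_ind: t => p; rewrite !formE; apply/form_eqP => s sn.
rewrite F_repE // !act_repE // F_repE // ghostF ?(ltnW sn) //.
have [k ->] := psum_wittF x (ltnW sn).
have [l ->] := @psum_act n.+1 x p s.+2 (leqW sn).
have [m ->] := ghost_mod2 x s.+1.
set a := psum (vcoord x) _; set b := psum _ _; set c := psum (nth 0 (F_rep _ _)) _.
by apply/dvdzP; exists (a * b + l - m * b - k * c); rewrite !exprS; ring.
Qed.

Lemma psum_wittV (x : witt n int) s : (s < n)%N ->
  psum (vcoord (wittV x)) s.+2 = ghost x 0 + psum (vcoord x) s.+1.
Proof.
elim: s => [|s IHs] sn; rewrite psumS vcoord_VS //.
  by rewrite !psum1 addrC.
by rewrite IHs ?(ltnW sn) // psumS addrA.
Qed.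

(** By [psum_wittV], A(V(x)) is w_0(x) plus A(x): the first part produces the correction term of
    F(b), the second matches A(x) A(F(b)) by [psum_F]. *)
Lemma form_V_actr (x : witt n int) t :
  form_act (wittV x) t = form_V (form_act x (form_F t)).
Proof.
elim/form_ind: t => p; rewrite !formE; apply/form_eqP => -[|s] sn.
  (* At the index 1 the modulus is 2: the left side is zero since w_0(V(x)) = 0, and V yields an
     even coefficient. *)
  rewrite act_repE // ghostV0 !psum1 V_repE.
  by apply/dvdzP; exists (- (act_rep x (F_rep n p))`_0); rewrite expr1; ring.
have s_n : (s < n)%N := ltnW (sn : (s.+1 < n)%N).
rewrite act_repE // V_repE act_repE // F_repE // ghostV //.
rewrite psum_wittV //; set a := psum (vcoord x) _; set b := psum _ _.
have [k kE] := ghost_mod2 x s.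
(* For s = 0 [psum_F] does not apply, but then the factor a is an empty sum. *)
have [l lE] : exists l, a * psum (nth 0 (F_rep n p)) s.+1 = a * b + 2 * l.
  case: s @a @b {sn} s_n kE => [|s] a b s_n _.
    by exists 0; rewrite /a psum1; ring.
  have [l lE] := @psum_F n p s.+1 s_n.
  by exists (a * l); rewrite lE /b; ring.
rewrite -[2 ^+ s * a * _]mulrA lE kE; apply/dvdzP; exists (- l - k * b).
by rewrite !exprS mulr2n; ring.
Qed.

(** The projection formula with the 1-form under V; with [form_V_actr] it covers both mixed products
    in [model_VM]. *)
Lemma form_V_actl (y : witt n.+1 int) t :
  form_act y (form_V t) = form_V (form_act (wittF y) t).
Proof.
elim/form_ind: t => p; rewrite !formE; apply/form_eqP => -[|s] sn.
  rewrite act_repE // !V_repE; set c := psum _ _; set q := act_rep _ _.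
  by apply/dvdzP; exists (ghost y 0 * p`_0 - q`_0 ); rewrite /c psum1; ring.
have s_n : (s < n)%N := ltnW (sn : (s.+1 < n)%N).
rewrite act_repE // !V_repE act_repE // ghostF //.
have [k ->] := psum_V p s.+2; have [l ->] := psum_wittF y s_n.
set a := psum _ _; set b := psum _ _.
by apply/dvdzP; exists (a * k - l * b); rewrite !exprS; ring.
Qed.

Lemma form_FV (t : wform n) : form_F (form_V t) = t *+ 2.
Proof.
elim/form_ind: t => p; rewrite !formE -raddfMn; apply/form_eqP => s sn.
rewrite F_repE // V_repE coefMn; have [k ->] := psum_V p s.+2.
by apply/dvdzP; exists k; rewrite exprS mulr2n; ring.
Qed.

End FormMaps.

Lemma form_RF n (t : wform n.+2) : form_R (form_F t) = form_F (form_R t).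
Proof.
elim/form_ind: t => p; rewrite !formE; apply: form_eq => s sn.
by rewrite !F_repE // ltnW.
Qed.

Lemma form_RV n (t : wform n.+1) : form_R (form_V t) = form_V (form_R t).
Proof. by elim/form_ind: t => p; rewrite !formE. Qed.

(** The polynomial with coefficients 2^(s-1) represents dlog[-1], as [model_iotaE] shows. Its
    leading contribution w_s(x) 2^s comes from the term w_0(x) of A(V(x)). *)
Lemma form_FdV n (x : witt n int) :
  form_F (form_d (wittV x)) =
  form_d x + form_act x (\pi_(wform n) (\poly_(s < n) 2 ^+ s.-1)).
Proof.
rewrite /form_d !formE -raddfD; apply/form_eqP => s sn.
rewrite coefD F_repE // !d_repE // act_repE // vcoord_VS ?(ltnW sn) //.
rewrite psum_d ?(leqW sn) // psum_wittV ?(ltnW sn) //.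
rewrite coef_poly sn psum_poly ?(ltnW sn) //.
have [k ->] := ghost_mod2 x s; set a := psum _ _.
(* The sum 1 + 2 + ... + 2^(s-1) is odd unless it is empty. *)
have [l ->] : exists l, psum (fun i => 2 ^+ i.-1) s.+1 = (0 < s)%N%:R + 2 * l.
  elim: s {sn k a} => [|s [l IHs]]; first by exists 0; rewrite psum1.
  rewrite psumS IHs; case: s {IHs} => [|s]; rewrite ?ltnn ?ltn0Sn /=.
    by exists l; ring.
  by exists (l + 2 ^+ s); rewrite exprS; ring.
case: s sn @a => [|s] sn a; rewrite ?ltnn ?ltn0Sn /=.
  by apply/dvdzP; exists (- k - a * l); rewrite /a psum1; ring.
by apply/dvdzP; exists (- k - a * l); rewrite !exprS; ring.
Qed.

Lemma wittR_teich n (a : int) : wittR (teich n.+1 a) = teich n a.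
Proof.
apply: ghost_int_inj => m mn.
by rewrite ghostR // !ghost_teich // ltnW.
Qed.

Lemma form_Fd_teich n (a : int) :
  form_F (form_d (teich n.+1 a)) = form_act (teich n a) (form_d (teich n a)).
Proof.
rewrite !formE; apply/form_eqP => s sn.
rewrite F_repE // act_repE // !d_repE // !psum_d ?(ltnW sn) ?(leqW sn) //.
have -> : psum (vcoord (teich n.+1 a)) s.+2 =
    psum (vcoord (teich n a)) s.+1 + vcoord (teich n a) s.+1.
  rewrite -psumS; apply: eq_psum => i i_s.
  by rewrite -(wittR_teich n) vcoord_R //; apply: leq_trans i_s sn.
have uE := ghostS (teich n a) s; have vE := ghostS (teich n.+1 a) s.+1.
rewrite !ghost_teich ?ltnS ?(ltnW sn) ?(leqW sn) // in uE vE *.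
have sqr k : a ^+ (2 ^ k.+1) = (a ^+ (2 ^ k)) ^+ 2 by rewrite expnSr exprM.
rewrite !sqr in uE vE; move: uE vE.
set u := a ^+ (2 ^ s); set c := vcoord _ s.+1; set c' := vcoord _ s.+2.
set A := psum _ _ => uE vE.
(* Square u^2 = u + 2^(s+1) c and compare with u^4 = u^2 + 2^(s+2) c'. *)
have c'E : c' = u * c + c ^+ 2 * 2 ^+ s.
  apply: (@mulIf _ (2 ^+ s.+2)); first by rewrite expf_eq0.
  apply: (addrI (u ^+ 2)); rewrite -vE {1}uE !exprS; ring.
(* What remains is 2^s (c^2 + c + A - A^2), whose second factor is even. *)
have /dvdzP[k kE] := dvdz2_sqrB A; have /dvdzP[l lE] := dvdz2_sqrB c.
apply/dvdzP; exists (l + c - k); rewrite c'E (exprS 2).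
transitivity (2 ^+ s * ((c ^+ 2 - c) + 2 * c - (A ^+ 2 - A))); first by ring.
by rewrite kE lE; ring.
Qed.

(** * The model *)

Lemma form_act0 n (t : wform n) : form_act 0 t = 0.
Proof. by have := form_actBl 0 0 t; rewrite !subrr. Qed.

Definition model n : Type := (witt n int * wform n)%type.

HB.instance Definition _ n := GRing.Zmodule.on (model n).

(** * Graded ring structure of the model *)

Section ModelRing.
Variable n : nat.
Implicit Types z : model n.

Definition model_mul z1 z2 : model n :=
  (z1.1 * z2.1, form_act z1.1 z2.2 + form_act z2.1 z1.2).

Fact model_mulA : associative model_mul.
Proof.
case=> [x t] [y u] [z v]; congr pair; rewrite /= ?mulrA //.
by rewrite !raddfD /= -!form_actM addrA [z * x]mulrC [z * y]mulrC.
Qed.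

Fact model_mulC : commutative model_mul.
Proof. by case=> [x t] [y u]; congr pair; rewrite /= 1?mulrC 1?addrC. Qed.

Fact model_mul1 : left_id ((1, 0) : model n) model_mul.
Proof.
case=> x t; rewrite /model_mul /= mul1r form_act1.
by rewrite (raddf0 (form_act x)) addr0.
Qed.

Fact model_mulDl : left_distributive model_mul +%R.
Proof.
case=> [x t] [y u] [z v]; congr pair; rewrite /= ?mulrDl //.
by rewrite form_actDl raddfD /= addrACA.
Qed.

HB.instance Definition _ := GRing.Zmodule_isComPzRing.Build (model n)
  model_mulA model_mulC model_mul1 model_mulDl.

Lemma modelM z1 z2 :
  z1 * z2 = (z1.1 * z2.1, form_act z1.1 z2.2 + form_act z2.1 z1.2).
Proof. by []. Qed.

Definition model_gr (i : nat) z : Prop :=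
  match i with 0 => z.2 = 0 | 1 => z.1 = 0 | _ => z = 0 end.

Fact model_gr_zero i : model_gr i 0.
Proof. by case: i => [|[|i]]. Qed.

Fact model_gr_sub i z1 z2 : model_gr i z1 -> model_gr i z2 -> model_gr i (z1 - z2).
Proof.
by case: i => [|[|i]] /= e1 e2; rewrite /= e1 e2 subrr.
Qed.

Fact model_gr_one : model_gr 0 1. Proof. by []. Qed.

Fact model_gr_mul i j z1 z2 :
  model_gr i z1 -> model_gr j z2 -> model_gr (i + j) (z1 * z2).
Proof.
case: i => [|[|i]]; case: j => [|[|j]]; case: z1 => [x t]; case: z2 => [y u] //=;
  rewrite /model_gr /= ?addn0 ?addn1 /=.
- by move=> -> ->; rewrite !raddf0 addr0.
- by move=> _ ->; rewrite mulr0.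
- by move=> _ ->; rewrite mulr0.
- by move=> ->; rewrite mul0r.
- move=> -> ->; rewrite modelM /= mul0r.
  by rewrite !form_act0 addr0.
- by move=> _ ->; rewrite mulr0.
- by move=> ->; rewrite mul0r.
- by move=> ->; rewrite mul0r.
- by move=> ->; rewrite mul0r.
Qed.

Fact model_gr_span z : exists k (c : nat -> model n),
  (forall i, model_gr i (c i)) /\ z = \sum_(i < k) c i.
Proof.
exists 2, (fun i => match i with 0 => (z.1, 0) | 1 => (0, z.2) | _ => 0 end).
split=> [[|[|i]] //|]; rewrite !big_ord_recl big_ord0 addr0.
by case: z => x t; congr pair; rewrite /= ?addr0 ?add0r.
Qed.

Fact model_gr_direct k (c : nat -> model n) :
  (forall i, model_gr i (c i)) -> \sum_(i < k) c i = 0 ->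
  forall i, (i < k)%N -> c i = 0.
Proof.
move=> gr_c c_sum [|[|i]] ik; last exact: gr_c i.+2.
  have := congr1 fst c_sum; rewrite (big_morph fst (id1 := 0) (op1 := +%R)) //.
  rewrite (bigD1 (Ordinal ik)) //= big1 => [|[[|[|j]] ?] //= _]; last 2 first.
  - exact: gr_c 1.
  - by rewrite (gr_c j.+2).
  by rewrite addr0 => c1; apply: injective_projections; last exact: gr_c 0.
have := congr1 snd c_sum; rewrite (big_morph snd (id1 := 0) (op1 := +%R)) //.
rewrite (bigD1 (Ordinal ik)) //= big1 => [|[[|[|j]] ?] //= _]; last 2 first.
- exact: gr_c 0.
- by rewrite (gr_c j.+2).
by rewrite addr0 => c1; apply: injective_projections; first exact: gr_c 1.
Qed.

End ModelRing.

Definition modelE n : gradedRing :=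
  @GradedRing (model n) (@model_gr n) (@model_gr_zero n) (@model_gr_sub n)
    (@model_gr_one n) (@model_gr_mul n) (@model_gr_span n) (@model_gr_direct n).


(** * Structure maps of the model *)

Section ModelMaps.
Variable n : nat.

Definition model_L (x : witt n int) : modelE n := (x, 0).
Definition model_R (z : modelE n.+1) : modelE n := (wittR z.1, form_R z.2).
Definition model_F (z : modelE n.+1) : modelE n := (wittF z.1, form_F z.2).
Definition model_V (z : modelE n) : modelE n.+1 := (wittV z.1, form_V z.2).
Definition model_d (z : modelE n) : modelE n := (0, form_d z.1).

Fact model_L_is_zmod_morphism : zmod_morphism model_L.
Proof. by move=> x y; congr pair; rewrite subrr. Qed.

Fact model_L_is_monoid_morphism : monoid_morphism model_L.
Proof. by split=> // x y; congr pair; rewrite /= !raddf0 addr0. Qed.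

HB.instance Definition _ := GRing.isZmodMorphism.Build
  (witt n int) (modelE n) model_L model_L_is_zmod_morphism.
HB.instance Definition _ := GRing.isMonoidMorphism.Build
  (witt n int) (modelE n) model_L model_L_is_monoid_morphism.

Fact model_R_is_zmod_morphism : zmod_morphism model_R.
Proof. by move=> [x t] [y u]; congr pair; rewrite /= raddfB. Qed.

Fact model_R_is_monoid_morphism : monoid_morphism model_R.
Proof.
split=> [|[x t] [y u]]; congr pair; rewrite /= ?rmorph1 ?raddf0 ?rmorphM //.
by rewrite raddfD /= !form_R_act.
Qed.

HB.instance Definition _ := GRing.isZmodMorphism.Build
  (modelE n.+1) (modelE n) model_R model_R_is_zmod_morphism.
HB.instance Definition _ := GRing.isMonoidMorphism.Build
  (modelE n.+1) (modelE n) model_R model_R_is_monoid_morphism.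

Fact model_F_is_zmod_morphism : zmod_morphism model_F.
Proof. by move=> [x t] [y u]; congr pair; rewrite /= raddfB. Qed.

Fact model_F_is_monoid_morphism : monoid_morphism model_F.
Proof.
split=> [|[x t] [y u]]; congr pair; rewrite /= ?rmorph1 ?raddf0 ?rmorphM //.
by rewrite raddfD /= !form_F_act.
Qed.

HB.instance Definition _ := GRing.isZmodMorphism.Build
  (modelE n.+1) (modelE n) model_F model_F_is_zmod_morphism.
HB.instance Definition _ := GRing.isMonoidMorphism.Build
  (modelE n.+1) (modelE n) model_F model_F_is_monoid_morphism.

Fact model_V_is_zmod_morphism : zmod_morphism model_V.
Proof. by move=> [x t] [y u]; congr pair; rewrite /= raddfB. Qed.

HB.instance Definition _ := GRing.isZmodMorphism.Build
  (modelE n) (modelE n.+1) model_V model_V_is_zmod_morphism.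

Fact model_d_is_zmod_morphism : zmod_morphism model_d.
Proof. by move=> [x t] [y u]; congr pair; rewrite /= ?subrr ?raddfB. Qed.

HB.instance Definition _ := GRing.isZmodMorphism.Build
  (modelE n) (modelE n) model_d model_d_is_zmod_morphism.

End ModelMaps.

(** * Witt complex axioms for the model *)

Definition model_iota n : modelE n :=
  model_d (model_L (teich n (-1))) * model_L (teich n (-1)).

(** Since [-1] = V(1) - 1, the form d[-1] is the first generator; the action of [-1] spreads it over
    all indices through the term 2^s A A, both partial sums being 1 for s > 0. *)
Lemma model_iotaE n : model_iota n = (0, \pi_(wform n) (\poly_(s < n) 2 ^+ s.-1)).
Proof.
have act_d : form_act (teich n (-1)) (form_d (teich n (-1))) =
    \pi_(wform n) (\poly_(s < n) 2 ^+ s.-1).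
  rewrite /form_d formE; apply/form_eqP => s sn.
  rewrite act_repE // d_repE // psum_d ?(ltnW sn) // coef_poly sn [_.-1]/=.
  rewrite ghost_teich ?(ltnW sn) //.
  have vE i : (i.+1 < n)%N -> vcoord (teich n (-1)) i.+1 = (i == 0%N)%:R.
    case: (n) => // m im; rewrite teichN1 vcoordB // vcoord1 // subr0.
    by rewrite vcoord_V1.
  have pE : psum (vcoord (teich n (-1))) s.+1 = (0 < s)%N%:R.
    elim: s sn => [|s IHs] sn; first exact: psum1.
    rewrite psumS IHs ?(ltnW sn) // vE ?(ltnW sn) //.
    by case: (s).
  rewrite vE // pE; case: s sn {pE} => [|s] _ /=.
    (* The first coefficient is w_0([-1]) = -1, which equals 1 modulo 2. *)
    by apply/dvdzP; exists (-1); rewrite expr1; ring.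
  by rewrite mulr0 !mulr1 add0r subrr dvdz0.
rewrite /model_iota modelM; congr pair; first exact: mul0r.
by rewrite /= form_act0 add0r act_d.
Qed.

Lemma model_mul11 n (z1 z2 : model n) : z1.1 = 0 -> z2.1 = 0 -> z1 * z2 = 0.
Proof.
by move=> z1_0 z2_0; rewrite modelM z1_0 z2_0 !form_act0 mul0r addr0.
Qed.

Fact model_comm n : graded_commutative (modelE n).
Proof.
case=> [|i] [|j] z1 z2 gr1 gr2; rewrite ?muln0 ?mul1r; try exact: mulrC.
have gr_fst k (z : modelE n) : gr k.+1 z -> z.1 = 0 by case: k => [|k] //= ->.
have [z1_0 z2_0] := (gr_fst _ _ gr1, gr_fst _ _ gr2).
by rewrite (model_mul11 z1_0 z2_0) (model_mul11 z2_0 z1_0) mulr0.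
Qed.

Fact model_zero (z : modelE 0) : z = 0.
Proof.
case: z => x t; congr pair; first by apply: wittP => -[].
by elim/form_ind: t => p; rewrite -(raddf0 \pi_(wform 0)); apply: form_eq.
Qed.

Fact model_R_graded n : graded_map 0 (@model_R n).
Proof. by move=> [|[|i]] z /= gr_z; rewrite ?addn0 /= ?gr_z ?raddf0. Qed.

Fact model_F_graded n : graded_map 0 (@model_F n).
Proof. by move=> [|[|i]] z /= gr_z; rewrite ?addn0 /= ?gr_z ?raddf0. Qed.

Fact model_V_graded n : graded_map 0 (@model_V n).
Proof. by move=> [|[|i]] z /= gr_z; rewrite ?addn0 /= ?gr_z ?raddf0. Qed.

Fact model_d_graded n : graded_map 1 (@model_d n).
Proof.
move=> [|i] z gr_z //; rewrite addn1 /=.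
by case: i gr_z => [|i] /= gr_z; rewrite /model_d gr_z raddf0.
Qed.

Fact model_L_R n (x : witt n.+1 int) : model_R (model_L x) = model_L (wittR x).
Proof. by congr pair; rewrite /= raddf0. Qed.

Fact model_RF n (z : modelE n.+2) : model_R (model_F z) = model_F (model_R z).
Proof. by congr pair; rewrite /= ?wittRF ?form_RF. Qed.

Fact model_F_L n (x : witt n.+1 int) : model_L (wittF x) = model_F (model_L x).
Proof. by congr pair; rewrite /= raddf0. Qed.

Fact model_RV n (z : modelE n.+1) : model_R (model_V z) = model_V (model_R z).
Proof. by congr pair; rewrite /= ?wittRV ?form_RV. Qed.

Fact model_VM n (z1 : modelE n) (z2 : modelE n.+1) :
  model_V z1 * z2 = model_V (z1 * model_F z2).
Proof.
rewrite modelM; congr pair; rewrite /= ?wittVM //.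
by rewrite form_V_actr form_V_actl raddfD.
Qed.

Fact model_V_L n (x : witt n int) : model_L (wittV x) = model_V (model_L x).
Proof. by congr pair; rewrite /= raddf0. Qed.

Fact model_FV n (z : modelE n) : model_F (model_V z) = z *+ 2.
Proof. by rewrite mulr2n; congr pair; rewrite /= ?wittFV ?form_FV mulr2n. Qed.

Fact model_Rd n (z : modelE n.+1) : model_R (model_d z) = model_d (model_R z).
Proof. by congr pair; rewrite /= ?raddf0 ?form_R_d. Qed.

Fact model_dM n i (z1 z2 : modelE n) : gr i z1 ->
  model_d (z1 * z2) = model_d z1 * z2 + (-1) ^+ i * (z1 * model_d z2).
Proof.
case: i => [|i] gr_z1.
  rewrite mul1r !modelM; congr pair; rewrite /= ?mul0r ?mulr0 ?addr0 //.
  by rewrite form_act_d !form_act0 addr0 add0r addrC.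
have z1_0 : z1.1 = 0 by case: i gr_z1 => [|i] //= ->.
rewrite [z1 * model_d _]model_mul11 // mulr0 addr0.
by rewrite /model_d z1_0 [(z1 * z2).1]/= z1_0 mul0r raddf0 mul0r.
Qed.

Fact model_FdV n (z : modelE n) :
  model_F (model_d (model_V z)) = model_d z + model_iota n * z.
Proof.
rewrite model_iotaE; congr pair; rewrite /= ?raddf0 ?mul0r ?addr0 //.
by rewrite form_FdV form_act0 add0r.
Qed.

Fact model_iota_fst n : (model_iota n).1 = 0.
Proof. exact: mul0r. Qed.

(** Both dz and eta z have zero component in degree 0, the only one that the d of the model sees, so
    both sides vanish. *)
Fact model_dd n (z : modelE n) :
  model_d (model_d z) = model_d (model_iota n * z).
Proof.
have iz_0 : (model_iota n * z).1 = 0 := etrans (congr1 (fun x => x * z.1)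
  (model_iota_fst n)) (mul0r _).
by rewrite /model_d iz_0.
Qed.

Fact model_di n (z : modelE n) :
  model_d (model_iota n * z) = model_iota n * model_d z.
Proof.
by rewrite -model_dd (model_mul11 (model_iota_fst n)) // /model_d raddf0.
Qed.

Fact model_Fd_teich n (a : int) :
  model_F (model_d (model_L (teich n.+1 a))) =
  model_L (teich n a) * model_d (model_L (teich n a)).
Proof.
rewrite modelM; congr pair; rewrite /= ?raddf0 ?mulr0 //.
by rewrite form_Fd_teich addr0.
Qed.

Definition model_wc : wittComplex int :=
  @WittComplex int modelE model_comm model_zero
  (fun n => @model_R n) model_R_graded
  (fun n => @model_L n) (fun n x => erefl) model_L_R
  (fun n => @model_F n) model_F_graded model_RF model_F_L
  (fun n => @model_V n) model_V_graded model_RV model_VM model_V_L model_FV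
  (fun n => @model_d n) model_d_graded model_Rd model_dM
  model_FdV model_dd model_di model_Fd_teich.

(** * Relations in a Witt complex over the integers *)

Section GradedRingTheory.
Variables (E : gradedRing) (i : nat).

Lemma gr_opp (x : E) : gr i x -> gr i (- x).
Proof. by move=> gr_x; rewrite -sub0r; apply: gr_sub => //; apply: gr_zero. Qed.

Lemma gr_add (x y : E) : gr i x -> gr i y -> gr i (x + y).
Proof.
by move=> gr_x gr_y; rewrite -[y]opprK; apply: gr_sub => //; apply: gr_opp.
Qed.

Lemma gr_mulz (x : E) (c : int) : gr i x -> gr i (x *~ c).
Proof.
move=> gr_x; have gr_mulrn k : gr i (x *+ k).
  by elim: k => [|k IHk]; [apply: gr_zero | rewrite mulrS; apply: gr_add].
case: c => k; first exact: gr_mulrn.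
by rewrite NegzE mulrNz; apply/gr_opp/(gr_mulrn k.+1).
Qed.

Lemma gr_sum (I : Type) (r : seq I) (P : pred I) (F : I -> E) :
  (forall j, P j -> gr i (F j)) -> gr i (\sum_(j <- r | P j) F j).
Proof.
move=> gr_F; apply: (big_ind (gr i)) => //; [exact: gr_zero | exact: gr_add].
Qed.

End GradedRingTheory.

Lemma wittR_V1 n i : wittR (wittV1 n.+1 i) = wittV1 n i.
Proof. by apply: vcoord_inj => s sn; rewrite vcoord_R // !vcoord_V1 // ltnW. Qed.

Lemma wittF_teich n (a : int) : wittF (teich n.+1 a) = teich n (a ^+ 2).
Proof.
by apply: ghost_int_inj => m mn; rewrite ghostF // !ghost_teich // expnS exprM.
Qed.

(** * The elements V^i(1), dV^i(1) and dlog[-1] of a Witt complex *)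

Section Relations.
Variable E : wittComplex int.
Local Notation V1 := (wcV1 E).
Local Notation dV1 := (wcdV1 E).
Local Notation L := (wcL E _).
Local Notation d := (wcd E _).
Local Notation F := (wcF E _).
Local Notation V := (wcV E _).
Local Notation m1 n := (wcL E n (teich n (-1))).

(** This is dlog[-1]; multiplication by it is iota ([wciE]). *)
Definition eta n : E n := wci E n 1.
Arguments eta : clear implicits.

Lemma wcV1_L n i : V1 n i = L (wittV1 n i).
Proof.
elim: i n => [|i IHi] [|n] //=; first by rewrite raddf0.
by rewrite wcV_L IHi.
Qed.

Lemma wcV1_0 n : V1 n 0 = 1.
Proof. by rewrite wcV1_L rmorph1. Qed.

Lemma wcV1_ge n i : (n <= i)%N -> V1 n i = 0.
Proof. by move=> ni; rewrite wcV1_L wittV1_ge // raddf0. Qed.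

Lemma gr_V1 n i : gr 0 (V1 n i).
Proof. by rewrite wcV1_L; apply: wcL_graded. Qed.

Lemma gr_d n (x : E n) : gr 0 x -> gr 1 (d x).
Proof. exact: (@wcd_graded _ E n 0 x). Qed.

Lemma gr_V n (x : E n) : gr 0 x -> gr 0 (V x).
Proof. exact: (@wcV_graded _ E n 0 x). Qed.

Lemma gr_dV1 n i : gr 1 (dV1 n i).
Proof. exact/gr_d/gr_V1. Qed.

Lemma mulC0 n i (x y : E n) : gr 0 x -> gr i y -> x * y = y * x.
Proof. by move=> gr_x gr_y; rewrite (wcE_comm gr_x gr_y) mul1r. Qed.

Lemma wcdM0 n (x y : E n) : gr 0 x -> d (x * y) = d x * y + x * d y.
Proof. by move=> gr_x; rewrite (wcd_mul _ gr_x) mul1r. Qed.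

Lemma wcd1 n : d (1 : E n) = 0.
Proof.
have := wcdM0 1 (gr_one (E n)); rewrite !mulr1 mul1r => /eqP.
by rewrite -subr_eq0 opprD addNKr oppr_eq0 => /eqP.
Qed.

Lemma dV1_0 n : dV1 n 0 = 0.
Proof. by rewrite /wcdV1 wcV1_0 wcd1. Qed.

Lemma dV1_ge n i : (n <= i)%N -> dV1 n i = 0.
Proof. by move=> ni; rewrite /wcdV1 wcV1_ge // raddf0. Qed.

Lemma wciE n (x : E n) : wci E n x = eta n * x.
Proof. by rewrite /eta /wci mulr1. Qed.

Lemma etaE n : eta n = d (m1 n) * m1 n.
Proof. exact: mulr1. Qed.

Lemma gr_eta n : gr 1 (eta n).
Proof.
rewrite etaE; apply: (@gr_mul _ 1 0); last exact: wcL_graded.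
exact/gr_d/wcL_graded.
Qed.

Lemma eta_comm n (x : E n) : gr 0 x -> x * eta n = eta n * x.
Proof. by move=> gr_x; apply: mulC0 gr_x (gr_eta n). Qed.

Lemma m1_comm n : m1 n * d (m1 n) = eta n.
Proof.
rewrite etaE; apply: mulC0; first exact: wcL_graded.
exact/gr_d/wcL_graded.
Qed.

(** Differentiate [-1]^2 = 1. *)
Lemma eta2 n : eta n *+ 2 = 0.
Proof.
have := wcdM0 (m1 n) (wcL_graded E (teich n (-1))).
rewrite -rmorphM -teichM mulrNN mulr1 teich1 rmorph1 wcd1 m1_comm -etaE.
by rewrite mulr2n.
Qed.

Lemma eta_mul2n n (x : E n) k : (0 < k)%N -> eta n * x *+ 2 ^ k = 0.
Proof. by case: k => // k _; rewrite expnS mulrnA -mulrnAl eta2 mul0r mul0rn. Qed.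

(** The Teichmüller axiom gives F(d[-1]) = [-1] d[-1], and F([-1]) = [1] = 1. *)
Lemma wcF_eta n : F (eta n.+1) = eta n.
Proof.
rewrite etaE rmorphM /= wcFd_teich -wcF_L wittF_teich sqrrN expr1n teich1 rmorph1.
by rewrite mulr1 m1_comm.
Qed.

Lemma wcV_eta n (x : E n) : V x * eta n.+1 = V (x * eta n).
Proof. by rewrite wcV_mul wcF_eta. Qed.

(* Compare V(1) d(V x) = V(F d V x) with the Leibniz rule for V(1) V(x) = 2 V(x). *)
Lemma wcV_d n (x : E n) : gr 0 x -> V (d x) = d (V x) *+ 2.
Proof.
move=> gr_x; have gr_Vx : gr 0 (V x) := gr_V gr_x.
have gr_V1 : gr 0 (V (1 : E n)) := gr_V (gr_one (E n)).
have := wcdM0 (V x) gr_V1.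
rewrite -(mulC0 gr_Vx (gr_d gr_V1)) !wcV_mul !mul1r wcFV !wcFdV wcd1 add0r.
rewrite !wciE mulr1 eta_comm // !raddfMn => ->.
rewrite raddfD addrCA -mulr2n -raddfMn.
by have := @eta_mul2n _ x 1 isT; rewrite expn1 => ->; rewrite raddf0 addr0.
Qed.

Lemma wcV_dV1 n i : V (dV1 n i) = dV1 n.+1 i.+1 *+ 2.
Proof. exact/wcV_d/gr_V1. Qed.

(** Induction through V d = 2 d V. This bounds the order from above; for initial E the lower bound
    is read off in the model, see [dV1_eq0]. *)
Lemma dV1_order n i : dV1 n i *+ 2 ^ i = 0.
Proof.
elim: i n => [|i IHi] [|n]; try by rewrite ?dV1_0 ?dV1_ge ?mul0rn.
by rewrite expnS mulrnA -wcV_dV1 -raddfMn IHi raddf0.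
Qed.

(** The correction term common to products, Frobenius and iota; by [V1_eta] it is V^i(1) eta. *)
Definition tail n i : E n := \sum_(i.+1 <= s < n) dV1 n s *+ 2 ^ s.-1.

Lemma wcV_tail n i : V (tail n i) = tail n.+1 i.+1.
Proof.
rewrite /tail raddf_sum [RHS]big_add1; apply: eq_big_nat => -[|s] // _.
by rewrite raddfMn /= wcV_dV1 -mulrnA -expnS.
Qed.

Lemma eta_tail n : eta n = tail n 0.
Proof.
elim: n => [|n IHn]; first by rewrite [LHS]wcE_zero [RHS]wcE_zero.
have gr_VV := gr_V1 n.+1 1.
(* Expand dlog[-1] with [-1] = V(1) - 1, using V(1) dV(1) = V(F(dV(1))) = V(eta). *)
have -> : eta n.+1 = dV1 n.+1 1 + V (eta n).
  have mE : m1 n.+1 = V1 n.+1 1 - 1 by rewrite teichN1 rmorphB wcV1_L rmorph1.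
  rewrite etaE mE raddfB wcd1 subr0 mulrBr mulr1.
  rewrite -(mulC0 gr_VV (gr_d gr_VV)) /= wcV_mul wcFdV.
  rewrite wcV1_0 wcd1 add0r mul1r -/(eta n) addrC; congr (_ + _).
  (* The expansion yields -dV(1), and the sign is immaterial because 2 dV(1) = 0. *)
  apply/eqP; rewrite /wcdV1 /= wcV1_0 eq_sym -subr_eq0 opprK -mulr2n; apply/eqP.
  by have := dV1_order n.+1 1; rewrite /wcdV1 /= wcV1_0.
rewrite IHn wcV_tail /tail; case: n {IHn gr_VV} => [|n].
  by rewrite !big_geq // dV1_ge // addr0.
by rewrite [RHS]big_ltn // mulr1n.
Qed.

(** As F(eta) = eta, the projection formula moves eta under V. *)
Lemma V1_eta n i : V1 n i * eta n = tail n i.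
Proof.
elim: i n => [|i IHi] n; first by rewrite wcV1_0 mul1r eta_tail.
case: n => [|n]; first by rewrite [LHS]wcE_zero [RHS]wcE_zero.
by rewrite /= wcV_eta IHi wcV_tail.
Qed.

Lemma V1_mul n i j : (i <= j)%N -> V1 n i * V1 n j = V1 n j *+ 2 ^ i.
Proof. by move=> ij; rewrite !wcV1_L -rmorphM wittV1_mulr // raddfMn. Qed.

Lemma wcF_dV1 n i : F (dV1 n.+1 i.+1) = dV1 n i + tail n i.
Proof. by rewrite /wcdV1 /= wcFdV wciE -eta_comm ?V1_eta //; apply: gr_V1. Qed.

(** Peel off one V from each factor: V(x) dV(y) = V(x F(dV(y))) = V(x (dy + eta y)). The maximum
    merges the two cases of the product formula. *)
Lemma V1_dV1 n i j : (0 < i)%N -> (0 < j)%N ->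
  V1 n i * dV1 n j = (if (i < j)%N then dV1 n j *+ 2 ^ i else 0) + tail n (maxn i j).
Proof.
case: i j => [|i] [|j] // _ _; elim: i j n => [|i IHi] j [|n];
  try by rewrite [LHS]wcE_zero [RHS]wcE_zero.
  rewrite [V1 _ _]/= wcV_mul wcV1_0 mul1r wcF_dV1 raddfD /= wcV_dV1 wcV_tail.
  rewrite (maxn_idPr (ltn0Sn j)); case: j => [|j] //.
  (* For i = j = 1 the recursion leaves 2 dV(1), which is zero. *)
  by have := dV1_order n.+1 1; rewrite expn1 => ->.
rewrite [V1 _ _]/= wcV_mul wcF_dV1 mulrDr raddfD -V1_eta mulrA.
case: j => [|j].
  by rewrite dV1_0 mulr0 raddf0 wcV1_0 mulr1 V1_eta wcV_tail.
rewrite -/(V1 n i.+1) IHi raddfD wcV_tail -[RHS]addr0 !maxnSS; congr (_ + _ + _).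
  by rewrite !ltnS; case: ifP; rewrite ?raddf0 // raddfMn /= wcV_dV1 -mulrnA -expnS.
(* The remaining term contains V^i(1) V^j(1) eta with both exponents positive, so a power of 2 kills
   eta. *)
have [ij|/ltnW ij] := leqP i.+1 j.+1.
  by rewrite V1_mul // mulrnAl eta_comm ?eta_mul2n ?raddf0 //; apply: gr_V1.
rewrite (mulC0 (gr_V1 _ _) (gr_V1 _ _)) V1_mul // mulrnAl eta_comm; last exact: gr_V1.
by rewrite eta_mul2n ?raddf0.
Qed.

Lemma wcdd_eta n (x : E n) : d (d x) = eta n * d x.
Proof. by rewrite wcdd wcdi wciE. Qed.

Lemma dV1_dV1 n i j : dV1 n i * dV1 n j = 0.
Proof.
case: i => [|i]; first by rewrite dV1_0 mul0r.
case: j => [|j]; first by rewrite dV1_0 mulr0.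
(* The mixed product is exact, being a combination of the dV^s(1). *)
have [w wE] : exists w, V1 n i.+1 * dV1 n j.+1 = d w.
  exists ((if (i.+1 < j.+1)%N then V1 n j.+1 *+ 2 ^ i.+1 else 0) +
    \sum_((maxn i.+1 j.+1).+1 <= s < n) V1 n s *+ 2 ^ s.-1).
  rewrite V1_dV1 // raddfD raddf_sum; congr (_ + _).
    by case: ifP; rewrite ?raddf0 // raddfMn.
  by apply: eq_bigr => s _; rewrite raddfMn.
(* All coefficients of the expansion are even, since s >= 2 in the tail, and 2 eta = 0. *)
have eta0 : eta n * (V1 n i.+1 * dV1 n j.+1) = 0.
  rewrite V1_dV1 // mulrDr mulr_sumr big_nat big1 => [|[|[|s]]].
  - by rewrite addr0; case: ifP; rewrite ?mulr0 // mulrnAr eta_mul2n.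
  - by rewrite ltn0.
  - by rewrite maxnSS ltnS ltn0.
  - by rewrite mulrnAr eta_mul2n.
(* Apply d to the mixed product. As dd = eta d, both d(dw) and the Leibniz term with ddV^j(1) are
   eta times that product, hence zero. *)
have := wcdM0 (dV1 n j.+1) (gr_V1 n i.+1).
rewrite {1}wE wcdd_eta -wE eta0 /wcdV1 wcdd_eta mulrA eta_comm; last exact: gr_V1.
by rewrite -mulrA eta0 addr0.
Qed.

Lemma eta_dV1 n i : eta n * dV1 n i = 0.
Proof.
rewrite eta_tail /tail mulr_suml big1 // => s _.
by rewrite mulrnAl dV1_dV1 mul0rn.
Qed.

Lemma wcd_dV1 n i : d (dV1 n i) = 0.
Proof. by rewrite wcdd_eta eta_dV1. Qed.

Lemma wcR_V1 n i : wcR E n (V1 n.+1 i) = V1 n i.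
Proof. by rewrite !wcV1_L wcL_strict wittR_V1. Qed.

Lemma wcR_dV1 n i : wcR E n (dV1 n.+1 i) = dV1 n i.
Proof. by rewrite /wcdV1 wcd_strict wcR_V1. Qed.

End Relations.

(** * The morphism from the model *)

Lemma ghost_V1 n i m : (m < n)%N -> ghost (wittV1 n i) m = (i <= m)%N%:R * 2 ^+ i.
Proof.
move=> mn; rewrite ghost_vcoord; case: leqP => im.
  rewrite (bigD1 (Ordinal (im : (i < m.+1)%N))) //= big1 => [|k].
    by rewrite vcoord_V1 ?eqxx ?addr0 //; apply: leq_ltn_trans mn.
  rewrite -val_eqE /= => /negbTE ki.
  by rewrite vcoord_V1 ?ki ?mul0r // (leq_trans (ltn_ord k)).
rewrite mul0r big1 // => k _; rewrite vcoord_V1 ?(leq_trans (ltn_ord k)) //.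
by rewrite ltn_eqF ?mul0r // (leq_trans (ltn_ord k)).
Qed.

Lemma psum_delta i s : psum (fun k => (k == i)%:R) s = (0 < i < s)%N%:R.
Proof.
case: s => [|s]; first by rewrite /psum big_geq // andbF.
elim: s => [|s IHs]; first by rewrite psum1 ltnS andbC; case: i.
by rewrite psumS IHs -natrD; congr (_%:R); lia.
Qed.

(** The counterpart of dV^s(1) in the model, see [form_d_V1]. *)
Definition formX n (s : nat) : wform n := \pi_(wform n) ('X^s : {poly int}).

Lemma wform_expand n (p : {poly int}) :
  \pi_(wform n) p = \sum_(s < n) formX n s *~ p`_s.
Proof.
transitivity (\pi_(wform n) (\sum_(s < n) 'X^s *~ p`_s)).
  apply: form_eq => s sn; rewrite coef_sum (bigD1 (Ordinal sn)) //= big1 => [|k].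
    by rewrite coefMrz coefXn eqxx addr0 intz.
  rewrite -val_eqE eq_sym /= => /negbTE ks.
  by rewrite coefMrz coefXn ks mul0rz.
by rewrite raddf_sum; apply: eq_bigr => s _; rewrite raddfMz.
Qed.

Lemma comb_ind (M : zmodType) (P : M -> Prop) n (g : nat -> M) (c : nat -> int) :
  P 0 -> (forall x y, P x -> P y -> P (x - y)) ->
  (forall i, (i < n)%N -> P (g i)) -> P (\sum_(i < n) g i *~ c i).
Proof.
move=> P0 Psub Pg.
have Popp x : P x -> P (- x) by move=> Px; rewrite -sub0r; apply: Psub.
have Padd x y : P x -> P y -> P (x + y).
  by move=> Px Py; rewrite -[y]opprK; apply: Psub => //; apply: Popp.
apply: big_ind => // i _; have := Pg i (ltn_ord i).
have Pmulrn k : P (g i) -> P (g i *+ k).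
  by move=> Pgi; elim: k => // k IHk; rewrite mulrS; apply: Padd.
case: (c i) => k Pgi; first exact: Pmulrn.
by rewrite NegzE mulrNz; apply/Popp/(Pmulrn k.+1).
Qed.

Lemma witt_gen n (P : witt n int -> Prop) :
  P 0 -> (forall x y, P x -> P y -> P (x - y)) ->
  (forall i, (i < n)%N -> P (wittV1 n i)) -> forall x, P x.
Proof. by move=> *; rewrite [X in P X]witt_expand; apply: comb_ind. Qed.

Lemma formX0 n : formX n 0 = 0.
Proof.
rewrite -(raddf0 \pi_(wform n)); apply: form_eq => s _.
by rewrite coefXn coef0.
Qed.

Lemma wform_gen n (P : wform n -> Prop) :
  P 0 -> (forall t u, P t -> P u -> P (t - u)) ->
  (forall j, (j.+1 < n)%N -> P (formX n j.+1)) -> forall t, P t.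
Proof.
move=> P0 Psub PX; elim/form_ind=> p; rewrite wform_expand.
by apply: (comb_ind _ P0) => // -[|i] ?; rewrite ?formX0 //; apply: PX.
Qed.

(** This is the coefficient pattern of V^i(1) dV^j(1) and of F(dV^j(1)), so that comparing model and
    complex becomes a comparison of coefficients. *)
Lemma sum_delta_tail (M : zmodType) (G : nat -> M) n j m (a : int) : (j < n)%N ->
  \sum_(s < n) G s *~ ((s == j :> nat)%:R * a + (m < s)%N%:R * 2 ^+ s.-1) =
  G j *~ a + \sum_(m.+1 <= s < n) G s *+ 2 ^ s.-1.
Proof.
move=> jn; rewrite (big_nat_widenl _ 0) // big_mkord [in RHS]big_mkcond.
transitivity (\sum_(s < n) ((if s == Ordinal jn then G s *~ a else 0) +
    (if (m < s)%N then G s *+ 2 ^ s.-1 else 0))).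
  apply: eq_bigr => s _; rewrite mulrzDr -val_eqE /=; congr (_ + _).
    by case: ifP; rewrite ?mul1r ?mul0r.
  by case: ifP; rewrite ?mul0r // mul1r -natrX pmulrn natz.
by rewrite big_split /=; congr (_ + _); rewrite -big_mkcond big_pred1_eq.
Qed.

(** * The comparison map on 1-forms and on the whole model *)

Section FromModel.
Variable E : wittComplex int.
Local Notation V1 := (wcV1 E).
Local Notation dV1 := (wcdV1 E).

Lemma dV1_dvd n s (c : int) : (2 ^+ s %| c)%Z -> dV1 n s *~ c = 0.
Proof.
case/dvdzP=> q ->; rewrite mulrC mulrzA -natrX natz -pmulrn.
by rewrite dV1_order mul0rz.
Qed.

Definition of_form n (t : wform n) : E n :=
  \sum_(s < n) dV1 n s *~ (repr t)`_s.

(** Independence of the representative: dV^s(1) is killed by 2^s. *)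
Lemma of_formE n p :
  of_form (\pi_(wform n) p) = \sum_(s < n) dV1 n s *~ p`_s.
Proof.
apply: eq_bigr => -[[|s] sn] _ /=; first by rewrite dV1_0 !mul0rz.
apply/eqP; rewrite -subr_eq0 -mulrzBr dV1_dvd //.
by move: s sn; apply/form_eqP; rewrite reprK.
Qed.

Fact of_form_is_zmod_morphism n : zmod_morphism (@of_form n).
Proof.
elim/form_ind=> p; elim/form_ind=> q; rewrite -raddfB !of_formE -sumrB.
by apply: eq_bigr => s _; rewrite coefB mulrzBr.
Qed.

HB.instance Definition _ n := GRing.isZmodMorphism.Build
  (wform n) (E n) (@of_form n) (@of_form_is_zmod_morphism n).

Lemma of_formX n j : (j < n)%N -> of_form (formX n j) = dV1 n j.
Proof.
move=> jn; rewrite of_formE (bigD1 (Ordinal jn)) //= big1 => [|k].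
  by rewrite coefXn eqxx addr0.
by rewrite -val_eqE /= coefXn => /negbTE ->.
Qed.

Lemma gr_of_form n t : gr 1 (@of_form n t).
Proof. by apply: gr_sum => s _; apply/gr_mulz/gr_dV1. Qed.

(** Both sides are biadditive, so it suffices to compare [V1_dV1] with the action on generators. *)
Lemma of_form_act n (x : witt n int) t :
  wcL E n x * of_form t = of_form (form_act x t).
Proof.
move: x t; apply: witt_gen => [t|x y IHx IHy t|[|i] i_n].
- by rewrite rmorph0 form_act0 raddf0 mul0r.
- by rewrite rmorphB form_actBl raddfB /= -IHx -IHy mulrBl.
- by move=> t; rewrite rmorph1 mul1r form_act1.
apply: wform_gen => [|t u IHt IHu|j jn].
- by rewrite !raddf0 mulr0.
- by rewrite !raddfB /= -IHt -IHu mulrBr.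
rewrite of_formX // -wcV1_L V1_dV1 // /formX formE of_formE.
transitivity (\sum_(s < n) dV1 n s *~ ((s == j.+1 :> nat)%:R *
    ((i.+1 < j.+1)%N%:R * 2 ^+ i.+1) + (maxn i.+1 j.+1 < s)%N%:R * 2 ^+ s.-1)).
  rewrite sum_delta_tail //; congr (_ + _).
  by case: ltnP; rewrite ?mul0r // mul1r -natrX natz -pmulrn.
apply: eq_bigr => -[[|s] sn] _; first by rewrite dV1_0 !mul0rz.
rewrite act_repE // coefXn ghost_V1 ?(ltnW sn) //; congr (_ *~ _).
(* The two partial sums are indicators, and their product is the condition that cuts out the tail
   beyond the maximum of the exponents. *)
have -> : psum (vcoord (wittV1 n i.+1)) s.+1 = (0 < i.+1 < s.+1)%N%:R.
  rewrite -psum_delta; apply: eq_psum => k ks.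
  by rewrite vcoord_V1 // (ltn_trans ks).
have -> : psum (nth 0 ('X^(j.+1) : {poly int})) s.+1 = (0 < j.+1 < s.+1)%N%:R.
  by rewrite -psum_delta; apply: eq_psum => k ks; rewrite coefXn.
rewrite /= gtn_max !ltnS eqSS; case: (eqVneq s j) => [->|_] /=.
  by rewrite ltnn andbF !mul0r !mulr0 mulr1 mul1r.
by case: (i < s)%N; case: (j < s)%N; rewrite ?mul0r ?mulr0 ?add0r ?mul1r ?mulr1.
Qed.

Lemma wcR_of_form n t : wcR E n (of_form t) = of_form (form_R t).
Proof.
elim/form_ind: t => p; rewrite formE !of_formE big_ord_recr raddfD /=.
rewrite raddfMz /= wcR_dV1 dV1_ge // mul0rz addr0 raddf_sum.
by apply: eq_bigr => s _; rewrite raddfMz /= wcR_dV1.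
Qed.

Lemma wcF_of_form n t : wcF E n (of_form t) = of_form (form_F t).
Proof.
move: t; apply: wform_gen => [|t u IHt IHu|j jn]; first by rewrite !raddf0.
  by rewrite !raddfB /= IHt IHu.
rewrite of_formX // wcF_dV1 /formX formE of_formE.
transitivity (\sum_(s < n) dV1 n s *~ ((s == j :> nat)%:R * 1 +
    (j < s)%N%:R * 2 ^+ s.-1)); first by rewrite sum_delta_tail.
apply: eq_bigr => -[[|s] sn] _; first by rewrite dV1_0 !mul0rz.
rewrite F_repE // coefXn /= mulr1; congr (_ *~ (_ + _)).
have -> : psum (nth 0 ('X^(j.+1) : {poly int})) s.+2 = (0 < j.+1 < s.+2)%N%:R.
  by rewrite -psum_delta; apply: eq_psum => k ks; rewrite coefXn.
by rewrite ltn0Sn ltnS mulrC.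
Qed.

Lemma wcV_of_form n t : wcV E n (of_form t) = of_form (form_V t).
Proof.
move: t; apply: wform_gen => [|t u IHt IHu|j jn]; first by rewrite !raddf0.
  by rewrite !raddfB /= IHt IHu.
rewrite of_formX // wcV_dV1 /formX formE /V_rep -exprS raddfMn raddfMn /=.
by rewrite -/(formX n.+1 j.+2) of_formX.
Qed.

Lemma wcd_L n x : wcd E n (wcL E n x) = of_form (form_d x).
Proof.
rewrite of_formE {1}[x]witt_expand !raddf_sum; apply: eq_bigr => -[s sn] _ /=.
by rewrite d_repE // rmorphMz /= raddfMz /= -wcV1_L.
Qed.

Lemma of_formM n t u : @of_form n t * of_form u = 0.
Proof.
rewrite mulr_suml big1 // => s _; rewrite mulr_sumr big1 // => k _.
by rewrite mulrzAl mulrzAr dV1_dV1 !mul0rz.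
Qed.

Lemma wcd_of_form n (t : wform n) : wcd E n (of_form t) = 0.
Proof. by rewrite raddf_sum big1 // => s _; rewrite raddfMz /= wcd_dV1 mul0rz. Qed.

Definition of_model n (z : model_wc n) : E n := wcL E n z.1 + of_form z.2.

Fact of_model_is_zmod_morphism n : zmod_morphism (@of_model n).
Proof.
by move=> z1 z2; rewrite /of_model /= rmorphB raddfB /= opprD addrACA.
Qed.

Fact of_model_is_monoid_morphism n : monoid_morphism (@of_model n).
Proof.
split=> [|z1 z2]; first by rewrite /of_model /= rmorph1 raddf0 addr0.
rewrite /of_model /= rmorphM raddfD /= -!of_form_act mulrDl !mulrDr.
rewrite of_formM addr0 -addrA; congr (_ + (_ + _)).
exact: mulC0 (wcL_graded _ _) (gr_of_form _).
Qed.

HB.instance Definition _ n := GRing.isZmodMorphism.Build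
  (model_wc n) (E n) (@of_model n) (@of_model_is_zmod_morphism n).
HB.instance Definition _ n := GRing.isMonoidMorphism.Build
  (model_wc n) (E n) (@of_model n) (@of_model_is_monoid_morphism n).

Fact of_model_graded n : graded_map 0 (@of_model n).
Proof.
case=> [|[|i]] z gr_z; rewrite addn0 /of_model gr_z.
- by rewrite raddf0 addr0; apply: wcL_graded.
- by rewrite rmorph0 add0r; apply: gr_of_form.
- by rewrite /= rmorph0 raddf0 addr0; apply: gr_zero.
Qed.

Fact of_model_R n (z : model_wc n.+1) :
  of_model (wcR model_wc n z) = wcR E n (of_model z).
Proof. by rewrite [RHS]raddfD /= wcL_strict wcR_of_form. Qed.

Fact of_model_L n x : of_model (wcL model_wc n x) = wcL E n x.
Proof. by rewrite /of_model raddf0 addr0. Qed.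

Fact of_model_F n (z : model_wc n.+1) :
  of_model (wcF model_wc n z) = wcF E n (of_model z).
Proof. by rewrite [RHS]raddfD /= -wcF_L wcF_of_form. Qed.

Fact of_model_V n (z : model_wc n) :
  of_model (wcV model_wc n z) = wcV E n (of_model z).
Proof. by rewrite [RHS]raddfD /= -wcV_L wcV_of_form. Qed.

Fact of_model_d n (z : model_wc n) :
  of_model (wcd model_wc n z) = wcd E n (of_model z).
Proof.
by rewrite [RHS]raddfD /= wcd_L wcd_of_form addr0 /of_model rmorph0 add0r.
Qed.

Definition of_model_morphism : wittMorphism model_wc E :=
  @WittMorphism int model_wc E (fun n => @of_model n) of_model_graded
    of_model_R of_model_L of_model_F of_model_V of_model_d.

End FromModel.

(** * Composites and identities of morphisms of Witt complexes *)

Section Composition.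
Variables (A : comPzRingType) (E1 E2 E3 : wittComplex A).
Variables (f : wittMorphism E1 E2) (g : wittMorphism E2 E3).

Definition wm_comp : wittMorphism E1 E3.
Proof.
exists (fun n => g n \o f n) => n.
- by move=> i x gr_x /=; have := wm_graded g (wm_graded f gr_x); rewrite !addn0.
- by move=> x /=; rewrite !wm_R.
- by move=> x /=; rewrite !wm_L.
- by move=> x /=; rewrite !wm_F.
- by move=> x /=; rewrite !wm_V.
- by move=> x /=; rewrite !wm_d.
Defined.

Definition wm_id : wittMorphism E1 E1.
Proof.
by exists (fun n => idfun) => n // i x; rewrite addn0.
Defined.

End Composition.

(** * The initial Witt complex *)

Lemma form_d_V1 n s : form_d (wittV1 n s) = formX n s.
Proof.
apply: form_eq => k kn.
by rewrite d_repE // vcoord_V1 // coefXn.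
Qed.

(** * Retraction of the model onto E and the direct sum decompositions *)

Section Initial.
Variable E : wittComplex int.
Hypothesis E_dRW : is_deRhamWitt E.
Local Notation V1 := (wcV1 E).
Local Notation dV1 := (wcdV1 E).

(** The composite through the model and the identity are both endomorphisms of E, and initiality
    allows only one. *)
Lemma to_model_exists :
  exists f : wittMorphism E model_wc, forall n x, of_model E (f n x) = x.
Proof.
have [f _] := E_dRW model_wc; exists f => n x.
have [h h_uniq] := E_dRW E.
have := h_uniq (wm_comp f (of_model_morphism E)) n x.
by rewrite -(h_uniq (wm_id E)).
Qed.

Lemma wcL_inj n (x : witt n int) : wcL E n x = 0 -> x = 0.
Proof.
have [f _] := to_model_exists => /(congr1 (f n)).
by rewrite rmorph0 wm_L => -[].
Qed.

(** The map f respects d and lambda, so it sends dV^s(1) to [formX n s] and recovers t from its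
    image. *)
Lemma of_form_inj n (t : wform n) : of_form E t = 0 -> t = 0.
Proof.
have [f _] := to_model_exists => /(congr1 (fun x => (f n x).2)).
rewrite rmorph0 /= => <-; elim/form_ind: t => p.
rewrite of_formE wform_expand rmorph_sum (big_morph snd (id1 := 0) (op1 := +%R)) //.
apply: eq_bigr => s _; rewrite rmorphMz wm_d wcV1_L wm_L.
rewrite -form_d_V1.
have snd_mulz (z : model n) c : (z *~ c).2 = z.2 *~ c := raddfMz snd c z.
by rewrite snd_mulz.
Qed.

(** As f preserves degrees and [of_model] undoes f, each graded piece of E comes from that of the
    model. *)
Lemma gr0_L n (x : E n) : gr 0 x -> exists w, x = wcL E n w.
Proof.
have [f fK] := to_model_exists => /(wm_graded f) /= f_x.
by exists (f n x).1; rewrite -[LHS]fK /of_model f_x raddf0 addr0.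
Qed.

Lemma gr1_form n (x : E n) : gr 1 x -> exists t, x = of_form E t.
Proof.
have [f fK] := to_model_exists => /(wm_graded f) /= f_x.
by exists (f n x).2; rewrite -[LHS]fK /of_model f_x rmorph0 add0r.
Qed.

Lemma gr_ge2 n i (x : E n) : (2 <= i)%N -> gr i x -> x = 0.
Proof.
case: i => [|[|i]] // _; have [f fK] := to_model_exists => /(wm_graded f) /= f_x.
by rewrite -[LHS]fK f_x /of_model /= rmorph0 raddf0 addr0.
Qed.

Lemma sum_V1 n (c : nat -> int) :
  \sum_(0 <= i < n) V1 n i *~ c i = wcL E n (\sum_(i < n) wittV1 n i *~ c i).
Proof.
rewrite big_mkord rmorph_sum; apply: eq_bigr => i _.
by rewrite rmorphMz wcV1_L.
Qed.

Lemma sum_dV1 n (c : nat -> int) :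
  \sum_(1 <= i < n.+1) dV1 n.+1 i *~ c i =
  of_form E (\pi_(wform n.+1) (\poly_(i < n.+1) c i)).
Proof.
rewrite of_formE big_ord_recl dV1_0 mul0rz add0r big_add1 big_mkord.
by apply: eq_bigr => i _; rewrite coef_poly ltnS ltn_ord.
Qed.

(** [wcL_inj] moves the question to W_n(Z), where [vcoord] reads off the coefficients. *)
Lemma cyclic_dsum0 n : is_cyclic_dsum (@gr (E n) 0) 0 n (V1 n) (fun=> 0%N).
Proof.
have V1_eq0 i c : (i < n)%N -> V1 n i *~ c = 0 -> c = 0.
  move=> i_n; rewrite wcV1_L -rmorphMz => /wcL_inj Vc.
  by have := vcoordMz (wittV1 n i) c i_n; rewrite Vc vcoord0 vcoord_V1 // eqxx intz.
split=> [x|c|i i_n c].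
- split=> [/gr0_L[w ->]|[c ->]].
    by exists (vcoord w); rewrite sum_V1 -witt_expand.
  by rewrite sum_V1; apply: wcL_graded.
- rewrite sum_V1 => /wcL_inj c0 i i_n.
  by rewrite -(vcoord_comb c (i_n : (i < n)%N)) c0 vcoord0.
- rewrite dvd0z; split=> [/V1_eq0 -> //|/eqP ->]; last exact: mulr0z.
Qed.

(** A relation c dV^s(1) = 0 pulls back along the injective [of_form] to make c X^s a null form,
    which is divisibility of c by 2^s. *)
Lemma dV1_eq0 n s (c : int) : (s < n)%N ->
  dV1 n s *~ c = 0 <-> ((2 ^ s)%N %| c)%Z.
Proof.
move=> sn; rewrite -natz natrX; split=> [|dvd_c]; last exact: dV1_dvd.
rewrite -of_formX // -raddfMz => /of_form_inj.
rewrite -raddfMz -(raddf0 \pi_(wform n)) => /form_eqP pc.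
case: s sn pc => [|s] sn pc; first by rewrite expr0 dvd1z.
by have := pc s sn; rewrite coef0 subr0 coefMrz coefXn eqxx intz.
Qed.

Lemma cyclic_dsum1 n :
  is_cyclic_dsum (@gr (E n.+1) 1) 1 n.+1 (dV1 n.+1) (fun i => 2 ^ i)%N.
Proof.
split=> [x|c|i /andP[_ i_n] c]; last exact: dV1_eq0.
- split=> [/gr1_form[t ->]|[c ->]]; last by rewrite sum_dV1; apply: gr_of_form.
  elim/form_ind: t => p; exists (nth 0 p); rewrite sum_dV1; congr of_form.
  by apply: form_eq => s sn; rewrite coef_poly sn.
- rewrite sum_dV1 => /of_form_inj.
  rewrite -(raddf0 \pi_(wform n.+1)) => /form_eqP c0 [|s] //= sn.
  by have := c0 s sn; rewrite coef_poly sn coef0 subr0; apply: dV1_dvd.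
Qed.

End Initial.
Theorem theorem4p1 (E : wittComplex int) (E_dRW : is_deRhamWitt E) (n : nat) :
  (* (i) *)
  [/\ is_cyclic_dsum (@gr (E n.+1) 0) 0 n.+1 (wcV1 E n.+1) (fun=> 0%N),
      is_cyclic_dsum (@gr (E n.+1) 1) 1 n.+1 (wcdV1 E n.+1) (fun i => 2 ^ i)%N
    & forall (i : nat) (x : E n.+1), (2 <= i)%N -> gr i x -> x = 0]
  /\
  (* (ii) *)
  [/\ forall i j : nat, (i <= j <= n)%N ->
        wcV1 E n.+1 i * wcV1 E n.+1 j = wcV1 E n.+1 j *+ 2 ^ i,
      forall i j : nat, (1 <= i < j)%N -> (j <= n)%N ->
        wcV1 E n.+1 i * wcdV1 E n.+1 j =
        wcdV1 E n.+1 j *+ 2 ^ i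
        + \sum_(j.+1 <= s < n.+1) wcdV1 E n.+1 s *+ 2 ^ s.-1
    & forall i j : nat, (1 <= j <= i)%N -> (i <= n)%N ->
        wcV1 E n.+1 i * wcdV1 E n.+1 j =
        \sum_(i.+1 <= s < n.+1) wcdV1 E n.+1 s *+ 2 ^ s.-1]
  /\
  (* (iii) *)
  (forall i : nat, (i <= n)%N ->
     wcV E n.+1 (wcV1 E n.+1 i) = wcV1 E n.+2 i.+1 /\
     wcV E n.+1 (wcdV1 E n.+1 i) = wcdV1 E n.+2 i.+1 *+ 2)
  /\
  (* (iv) *)
  (forall i : nat, (1 <= i <= n)%N ->
     wcF E n (wcV1 E n.+1 i) = wcV1 E n i.-1 *+ 2 /\
     wcF E n (wcdV1 E n.+1 i) =
       wcdV1 E n i.-1 + \sum_(i <= s < n) wcdV1 E n s *+ 2 ^ s.-1)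
  /\
  (* (v) *)
  [/\ forall i : nat, (1 <= i <= n)%N ->
        wcd E n.+1 (wcV1 E n.+1 i) = wcdV1 E n.+1 i,
      wcd E n.+1 1 = 0
    & forall i : nat, (i <= n)%N ->
        wci E n.+1 (wcV1 E n.+1 i) =
        \sum_(i.+1 <= s < n.+1) wcdV1 E n.+1 s *+ 2 ^ s.-1]
  /\
  (* (vi) *)
  (forall i : nat, (i < n)%N ->
     wcR E n (wcV1 E n.+1 i) = wcV1 E n i /\
     wcR E n (wcdV1 E n.+1 i) = wcdV1 E n i) /\
  wcR E n (wcV1 E n.+1 n) = 0 /\
  wcR E n (wcdV1 E n.+1 n) = 0.
Proof.
split; last split; last split; last split; last split; last split; last split.
- split; [exact: cyclic_dsum0 | exact: cyclic_dsum1 | exact: gr_ge2].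
- split=> [i j /andP[ij _]|i j /andP[i0 ij] _|i j /andP[j0 ji] _].
  + exact: V1_mul.
  + have j0 : (0 < j)%N by apply: leq_trans ij.
    by rewrite V1_dV1 // ij (maxn_idPr (ltnW ij)).
  + have i0 : (0 < i)%N by apply: leq_trans ji.
    by rewrite V1_dV1 // ltnNge ji add0r (maxn_idPl ji).
- by move=> i _; split; last exact: wcV_dV1.
- by case=> [|i] // _; split; [exact: wcFV | exact: wcF_dV1].
- split=> // [|i _]; first exact: wcd1.
  by rewrite wciE -eta_comm ?V1_eta //; apply: gr_V1.
- by move=> i _; split; [exact: wcR_V1 | exact: wcR_dV1].
- by rewrite wcR_V1 wcV1_ge.
- by rewrite wcR_dV1 dV1_ge.
Qed.
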